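(* Let $n\ge2$, $s>1$, $p\in(1,\infty)$, $\lambda\in[n-1,n)$ and $\delta,\tau\in(0,1)$, and suppose \[ s<\frac{n+1-\lambda}{1-\delta},\qquad p\le\frac{s(n-1)-\lambda+1}{n-s(1-\delta)-\lambda+1}. \] Then there is an $s$-John domain $G_s\subset\mathbb{R}^n$ with $\dim_{\mathcal M}(\partial G_s)=\lambda$ which does not support the fractional $(1,p)$-Poincaré inequality with parameters $\delta,\tau$, i.e. there is no $c<\infty$ such that for all $u\in L^p(G_s)$ \[ \int_{G_s}|u(x)-u_{G_s}|\,dx\le c\left(\int_{G_s}\int_{G_s\cap B^n(x,\tau\operatorname{dist}(x,\partial G_s))}\frac{|u(x)-u(y)|^p}{|x-y|^{n+\delta p}}\,dy\,dx\right)^{1/p}. \]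
   Context: A bounded domain $G\subset\mathbb{R}^n$ is an $s$-John domain ($s\ge1$) if there are $x_0\in G$ and $c>0$ such that every $x\in G$ can be joined to $x_0$ by a rectifiable arc-length parametrized curve $\gamma:[0,l]\to G$ with $\gamma(0)=x$, $\gamma(l)=x_0$, $l\le c$, and $\operatorname{dist}(\gamma(t),\partial G)\ge t^s/c$ for $t\in[0,l]$. Upper Minkowski dimension: $\dim_{\mathcal M}(E)=\sup\{\lambda\ge0:\limsup_{r\to0+}|E+B^n(0,r)|\,r^{\lambda-n}=\infty\}$. $u_{G_s}$ is the mean of $u$ over $G_s$. *)

(* Defs.v *)
(* mathcomp-analysis, over an abstract R : realType.
   R^n is modelled by n.-tuple R, which mathcomp-analysis equips with the
   product (Borel) sigma-algebra generated by the coordinate projections. *)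
From HB Require Import structures.
From mathcomp Require Import all_boot all_order all_algebra.
From mathcomp Require Import all_classical all_reals all_analysis.
Set Implicit Arguments.
Unset Strict Implicit.
Unset Printing Implicit Defensive.
Import Order.TTheory GRing.Theory Num.Theory.
Local Open Scope classical_set_scope.
Local Open Scope ring_scope.

Section Defs.
Variable R : realType.

Fixpoint lebn (n : nat) : set (n.-tuple R) -> \bar R :=
  match n with
  | 0 => fun A => (\1_A [tuple] )%:E
  | k.+1 => pushforward (lebesgue_measure \x (@lebn k))%E
              (fun p : R * k.-tuple R => [tuple of p.1 :: p.2])
  end.
Arguments lebn n _ : clear implicits.

Definition edist n (x y : n.-tuple R) : R :=
  Num.sqrt (\sum_(i < n) (tnth x i - tnth y i) ^+ 2).

Definition eball n (x : n.-tuple R) (r : R) : set (n.-tuple R) :=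
  [set y | edist x y < r].

Definition eopen n (G : set (n.-tuple R)) : Prop :=
  forall x, G x -> exists2 r : R, 0 < r & eball x r `<=` G.

Definition econnected n (G : set (n.-tuple R)) : Prop :=
  ~ (exists U V : set (n.-tuple R), eopen U /\ eopen V /\
       G `<=` U `|` V /\ U `&` V `&` G = set0 /\
       U `&` G !=set0 /\ V `&` G !=set0).

Definition ebounded n (G : set (n.-tuple R)) : Prop :=
  exists M : R, forall x y, G x -> G y -> edist x y <= M.

Definition bounded_domain n (G : set (n.-tuple R)) : Prop :=
  G !=set0 /\ eopen G /\ econnected G /\ ebounded G.

Definition boundary n (G : set (n.-tuple R)) : set (n.-tuple R) :=
  [set x | forall r : R, 0 < r ->
     (exists y, G y /\ edist x y < r) /\ (exists y, ~ G y /\ edist x y < r)].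

Definition dist_set n (x : n.-tuple R) (E : set (n.-tuple R)) : R :=
  inf [set edist x y | y in E].

Definition curve_length n (gamma : R -> n.-tuple R) (a b : R) : \bar R :=
  ereal_sup [set L | exists (k : nat) (t : nat -> R),
     [/\ t 0%N = a, t k = b, (forall i, (i < k)%N -> t i <= t i.+1) &
        L = (\sum_(i < k) edist (gamma (t i)) (gamma (t i.+1)))%:E]].

Definition arclength_param n (gamma : R -> n.-tuple R) (l : R) : Prop :=
  0 <= l /\ forall a b, 0 <= a -> a <= b -> b <= l ->
    curve_length gamma a b = (b - a)%:E.

Definition John_domain n (s : R) (G : set (n.-tuple R)) : Prop :=
  bounded_domain G /\
  exists x0, G x0 /\ exists2 c : R, 0 < c &
    forall x, G x -> exists (gamma : R -> n.-tuple R) (l : R),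
      [/\ arclength_param gamma l, gamma 0 = x, gamma l = x0, l <= c &
          forall t, 0 <= t -> t <= l ->
            G (gamma t) /\ powR t s / c <= dist_set (gamma t) (boundary G)].

Definition nbhd_set n (E : set (n.-tuple R)) (r : R) : set (n.-tuple R) :=
  [set x | exists2 y, E y & edist x y < r].

Definition minkowski_blowup n (E : set (n.-tuple R)) (lam : R) : Prop :=
  forall (M : R) (eps : R), 0 < eps ->
    exists r : R, [/\ 0 < r, r < eps &
      (M%:E < lebn n (nbhd_set E r) * (powR r (lam - n%:R))%:E)%E].

Definition minkowski_dim n (E : set (n.-tuple R)) : \bar R :=
  ereal_sup [set lam%:E | lam in [set lam : R | 0 <= lam /\ minkowski_blowup E lam]].

Definition in_Lp n (G : set (n.-tuple R)) (p : R) (u : n.-tuple R -> R) : Prop :=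
  measurable_fun G u /\
  (\int[lebn n]_(x in G) (powR `|u x| p)%:E < +oo)%E.

Definition mean n (G : set (n.-tuple R)) (u : n.-tuple R -> R) : R :=
  fine (\int[lebn n]_(x in G) (u x)%:E) / fine (lebn n G).

Definition fractional_poincare n (G : set (n.-tuple R)) (p delta tau : R) : Prop :=
  exists2 c : R, 0 < c & forall u, in_Lp G p u ->
    (\int[lebn n]_(x in G) (`|u x - mean G u|)%:E <=
     c%:E * poweR
       (\int[lebn n]_(x in G)
          \int[lebn n]_(y in G `&` eball x (tau * dist_set x (boundary G)))
             (powR `|u x - u y| p / powR (edist x y) (n%:R + delta * p))%:E)
       p^-1)%E.

End Defs.

(* Main.v *)
Require Import Defs.
From HB Require Import structures.
From mathcomp Require Import all_boot all_order all_algebra.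
From mathcomp Require Import all_classical all_reals all_analysis.
From mathcomp Require Import measurable_realfun ring lra.
Import Defs.
Set Implicit Arguments.
Unset Strict Implicit.
Unset Printing Implicit Defensive.
Import Order.TTheory GRing.Theory Num.Theory numFieldNormedType.Exports.
Local Open Scope classical_set_scope.
Local Open Scope ring_scope.

(** A Cantor dust of dimension [lam], with contraction ratio [kap] such that
[2^n kap^lam = 1], organises the domain. For every cell of generation [j] (of
size [kap^j]) the domain contains four open boxes: a plate through the cell
centre orthogonal to the zeroth axis, an arm along that axis reaching the plate
of the parent cell, a room, and a tube of length about [kap^j] and width about
[kap^(j s)] which joins the room to the plate. From any point one reaches the
origin by going to the centre of a box and then along arms and plates, with
clearance linear in the travelled length except inside the tubes: the domain is
[s]-John. Its boundary consists of the faces of the boxes and of the dust, hence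
has dimension [lam].

The test function is [kap^(j (lam - n))] in the rooms of the first [J]
generations, vanishes outside rooms and tubes, and is affine along the middle of
each tube. Each generation contributes one fixed positive amount to its
integral, and a bounded amount to the energy because a ball of radius
[tau dist(x, bd G)] on which the function is not constant is centred in a tube;
the bound on [p] is exactly what makes that last amount bounded. Letting [J]
tend to infinity, the Poincare inequality would give [J <= C J^(1/p)]. *)

(** The pieces may overlap freely; only tubes and rooms must be kept apart from everything else.
    This comes from the one-dimensional Cantor construction: around the centres of the cells of all
    generations there are cores whose projections on every axis are disjoint, so one coordinate of a
    point in a core determines the word on that axis and, through its length, the generation. The
    obstacle is that the test function jumps across the walls of a tube. A ball of radius [tau]
    times the distance d of its centre to the boundary lies in [G], so it can only enter through the
    mouth of the tube, where the complement is about a tube width away; then d <= tau d + width. As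
    [tau < 1], d is of the order of the width, and a small [alpha] makes it negligible against the
    tube length. The bound on [p] counts exponents. With k = [kap ^+ j], generation j has k^(-lam)
    tubes of volume about k^(1 + s(n-1)), the slope is about k^(lam-n-1), and the inner integral
    adds a factor k^(s p (1-delta)) to the p-th power of the slope. The condition lam >= n-1 keeps
    the faces, of dimension n-1, from outweighing the dust. *)

(* Both integrals are suprema over simple functions, so no measurability is needed. *)
Lemma ge0_le_integral_subset d (T : measurableType d) (R : realType)
    (mu : {measure set T -> \bar R}) (D E : set T) (f g : T -> \bar R) :
  (forall x, D x -> 0 <= f x)%E -> (forall x, E x -> 0 <= g x)%E ->
  (forall x, D x -> E x /\ (f x <= g x)%E) ->
  (\int[mu]_(x in D) f x <= \int[mu]_(x in E) g x)%E.
Proof.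
move=> f0 g0 fg; rewrite !ge0_integralE//.
apply: ereal_sup_le => _ [h /= hf <-]; exists h => //= x.
apply: le_trans (hf x) _; rewrite /patch.
case: ifPn => [|_].
  by rewrite inE => /fg[Ex fgx]; rewrite mem_set.
by case: ifPn => // /set_mem /g0.
Qed.

(** * Lebesgue measure on tuples: monotonicity, boxes, covers *)

(** Nonnegativity and monotonicity share one induction on the dimension, for arbitrary sets: the
    recursion integrates [lebn] of sections, and the integral is monotone once both integrands are
    nonnegative. *)
Lemma lebn_le (R : realType) n (A B : set (n.-tuple R)) :
  A `<=` B -> (lebn A <= lebn B)%E.
Proof.
suff: forall A B : set (n.-tuple R), A `<=` B ->
    (0 <= lebn A)%E /\ (lebn A <= lebn B)%E.
  by move=> /[apply] -[].
elim: n {A B} => [|n IH] A B AB /=.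
  rewrite !lee_fin !indicE ler_nat ler0n; split => //.
  by case: (boolP (_ \in A)) => //; rewrite inE => /AB /mem_set ->.
rewrite /pushforward /product_measure1; split.
  by apply: integral_ge0 => x _ /=; case: (IH _ _ (@subset_refl _ (xsection ((fun p : R * n.-tuple R => [tuple of p.1 :: p.2]) @^-1` A) x))).
apply: ge0_le_integral_subset => x _ /=.
- exact: (proj1 (IH _ _ (@subset_refl _ _))).
- exact: (proj1 (IH _ _ (@subset_refl _ _))).
- split=> //; apply: (proj2 (IH _ _ _)).
  by apply: le_xsection => p /=; exact: AB.
Qed.

Lemma measurable_cons_pair (R : realType) n :
  measurable_fun [set: measurableTypeR R * n.-tuple R]
    (fun p : measurableTypeR R * n.-tuple R =>
      [tuple of (p.1 : R) :: p.2] : n.+1.-tuple R).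
Proof.
apply: (@measurable_cons _ _ _ _ (fun p => p.1 : R) n (fun p => p.2)).
  exact: (@measurable_fst _ _ (measurableTypeR R) (n.-tuple R)).
exact: measurable_snd.
Qed.

(** Both covers are nondecreasing, so the rectangles with equal indices already exhaust the
    product. *)
Lemma product_measure_sigma_finiteT d1 d2 (T1 : measurableType d1)
    (T2 : measurableType d2) (R : realType)
    (m1 : {sigma_finite_measure set T1 -> \bar R})
    (m2 : {sigma_finite_measure set T2 -> \bar R}) :
  sigma_finite setT (m1 \x m2)%E.
Proof.
have /sigma_finiteP[F [TF ndF Foo]] := sigma_finiteT m1.
have /sigma_finiteP[G [TG ndG Goo]] := sigma_finiteT m2.
exists (fun k => F k `*` G k) => [|k].
  apply/seteqP; split => // -[x y] _.
  have [i _ Fi] : (\bigcup_i F i) x by rewrite -TF.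
  have [j _ Gj] : (\bigcup_i G i) y by rewrite -TG.
  exists (maxn i j) => //; split => /=.
    by move/subsetPset: (ndF _ _ (leq_maxl i j)); apply.
  by move/subsetPset: (ndG _ _ (leq_maxr i j)); apply.
have [mF Fk] := Foo k; have [mG Gk] := Goo k.
split; first exact: measurableX.
by rewrite product_measure1E// lte_mul_pinfty// ge0_fin_numE.
Qed.

(** [lebn] is a bare set function; this equality lets a proof trade it for a genuine measure.
    Sigma-finiteness is carried along because the next product requires it. *)
Lemma lebn_measure (R : realType) n :
  exists mu : {sigma_finite_measure set (n.-tuple R) -> \bar R},
    @lebn R n = mu.
Proof.
elim: n => [|n [m IH]] /=; first by exists (dirac [tuple]).
rewrite IH.
pose f (p : measurableTypeR R * n.-tuple R) := [tuple of (p.1 : R) :: p.2].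
have mf : measurable_fun setT f := @measurable_cons_pair R n.
pose mu : {measure set (measurableTypeR R * n.-tuple R)%type -> \bar R} :=
  (lebesgue_measure \x m)%E.
pose nu : {measure set (n.+1.-tuple R) -> \bar R} :=
  measure_function_pushforward__canonical__measure_function_Measure mu mf.
(* A left inverse of [f]: the cover [F] pulled back along [g] has the [F k] as preimages under
   [f]. *)
pose g (t : n.+1.-tuple R) : measurableTypeR R * n.-tuple R :=
  (tnth t ord0, [tuple of behead t]).
have mg : measurable_fun setT g.
  apply/measurable_fun_pair => //.
    exact: (@measurable_tnth _ R n.+1 ord0).
  exact: (@measurable_behead _ R n).
have gf p : g (f p) = p.
  by case: p => a t; rewrite /g /f /=; congr (_, _); apply/val_inj.
have nu_sf : sigma_finite setT nu.
  have [F FT Foo] := product_measure_sigma_finiteT (@lebesgue_measure R) m.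
  exists (fun k => g @^-1` F k).
    by rewrite -preimage_bigcup -FT preimage_setT.
  move=> k; have [mFk Fk] := Foo k; split.
    by rewrite -[X in measurable X]setTI; exact: mg.
  rewrite /= /pushforward -comp_preimage (_ : g \o f = id) ?preimage_id//.
  by apply/funext => p /=; rewrite gf.
pose nu' := HB.pack_for {sigma_finite_measure set (n.+1.-tuple R) -> \bar R}
  (nu : set _ -> \bar R) (Measure.on nu) (Measure_isSigmaFinite.Build _ _ _ nu nu_sf).
by exists nu'.
Qed.

Definition box (R : realType) n (e h : 'I_n -> R) : set (n.-tuple R) :=
  [set x | forall i, `|tnth x i - e i| < h i].

Lemma measurable_box (R : realType) n (e h : 'I_n -> R) : measurable (box e h).
Proof.
have -> : box e h = \bigcap_(i in [set: 'I_n])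
    ((fun x => tnth x i) @^-1` `]e i - h i, e i + h i[%classic).
  apply/seteqP; split => [x xB i _|x xB i].
    by rewrite /= in_itv /= -ltr_distl.
  by rewrite ltr_distl; have := xB i I; rewrite /= in_itv.
apply: fin_bigcap_measurable => // i _.
by rewrite -[X in measurable X]setTI; apply: measurable_tnth.
Qed.

Lemma lebn_box (R : realType) n (e h : 'I_n -> R) : (forall i, 0 <= h i) ->
  lebn (box e h) = (\prod_(i < n) (2 * h i))%:E.
Proof.
elim: n e h => [|n IH] e h h0.
  rewrite /= big_ord0 indicE mem_set//.
  by case.
have [mu muE] := lebn_measure R n.
have -> : lebn (box e h) =
  (lebesgue_measure \x mu)%E (`]e ord0 - h ord0, e ord0 + h ord0[ `*`
    box (fun i => e (lift ord0 i)) (fun i => h (lift ord0 i))).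
  rewrite /= -muE /pushforward; congr (_ _).
  apply/seteqP; split => -[a t] /=.
    move=> xB; split; first by rewrite in_itv /= -ltr_distl; exact: (xB ord0).
    by move=> i /=; have := xB (lift ord0 i); rewrite tnthS.
  move=> [+ tB] i; rewrite in_itv /= -ltr_distl => aB.
  by case: (unliftP ord0 i) => [j|] -> //; rewrite tnthS; exact: tB.
rewrite product_measure1E//; last exact: measurable_box.
have -> : mu (box (fun i => e (lift ord0 i)) (fun i => h (lift ord0 i))) =
    (\prod_(i < n) (2 * h (lift ord0 i)))%:E.
  by rewrite -muE; apply: IH.
transitivity ((2 * h ord0)%:E * (\prod_(i < n) (2 * h (lift ord0 i)))%:E)%E.
  congr (_ * _)%E; set A := (X in _ X = _).
  change (lebesgue_measure A = (2 * h ord0)%:E); rewrite {}/A.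
  rewrite lebesgue_measure_itv /= lte_fin.
  case: ltP => he; first by rewrite -EFinD; congr (_%:E); ring.
  by have -> : h ord0 = 0; [have := h0 ord0; lra|rewrite mulr0].
by rewrite big_ord_recl EFinM.
Qed.

Lemma lebn_bigcup_le (R : realType) n (I : Type) (r : seq I)
    (F : I -> set (n.-tuple R)) :
  (forall i, measurable (F i)) ->
  (lebn (\big[setU/set0]_(i <- r) F i) <= \sum_(i <- r) lebn (F i))%E.
Proof.
have [mu ->] := lebn_measure R n => mF.
elim: r => [|i r IH]; first by rewrite !big_nil measure0.
rewrite !big_cons; apply: le_trans (leeD2l _ IH).
apply: measureU2 => //; exact: bigsetU_measurable.
Qed.

(** * Euclidean distance and boundaries *)

Section EuclideanDistance.
Context {R : realType} {n : nat}.
Implicit Types (x y z : n.-tuple R).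

(** Cauchy-Schwarz, from the quadratic polynomial [quad] at its minimiser [P / B]. *)
Lemma sum_mul_sqr_le (a b : 'I_n -> R) :
  (\sum_i a i * b i) ^+ 2 <= (\sum_i a i ^+ 2) * (\sum_i b i ^+ 2).
Proof.
set P := \sum_i a i * b i; set A := \sum_i a i ^+ 2; set B := \sum_i b i ^+ 2.
have B0 : 0 <= B by apply: sumr_ge0 => i _; exact: sqr_ge0.
have quad t : 0 <= A - 2 * t * P + t ^+ 2 * B.
  rewrite (_ : _ + _ = \sum_i (a i - t * b i) ^+ 2).
    by apply: sumr_ge0 => i _; exact: sqr_ge0.
  rewrite /A /B /P !mulr_sumr -sumrB -big_split /=.
  by apply: eq_bigr => i _; ring.
have [B00|Bn0] := eqVneq B 0.
  have P0 : P = 0.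
    rewrite /P big1// => i _.
    have /eqP := B00; rewrite psumr_eq0; last by move=> j _; exact: sqr_ge0.
    move/allP => /(_ i); rewrite mem_index_enum => /(_ isT) /=.
    by rewrite sqrf_eq0 => /eqP ->; rewrite mulr0.
  by rewrite P0 B00 mulr0 expr0n.
have Bp : 0 < B by rewrite lt_def Bn0.
have := quad (P / B); rewrite -(pmulr_rge0 _ Bp).
rewrite (_ : B * _ = A * B - P ^+ 2) ?subr_ge0//.
by field.
Qed.

Lemma edist_ge0 x y : 0 <= edist x y.
Proof. exact: sqrtr_ge0. Qed.

Lemma edistxx x : edist x x = 0.
Proof.
by rewrite /edist big1 ?sqrtr0// => i _; rewrite subrr expr0n.
Qed.

Lemma edistC x y : edist x y = edist y x.
Proof. by congr Num.sqrt; apply: eq_bigr => i _; rewrite -sqrrN opprB. Qed.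

Lemma edist_triangle y x z : edist x z <= edist x y + edist y z.
Proof.
have sum0 (f : 'I_n -> R) : 0 <= \sum_i f i ^+ 2.
  by apply: sumr_ge0 => i _; exact: sqr_ge0.
rewrite -(ler_pXn2r (_ : (0 < 2)%N))// ?nnegrE ?addr_ge0 ?edist_ge0//.
pose a i := tnth x i - tnth y i; pose b i := tnth y i - tnth z i.
rewrite sqrrD !sqr_sqrtr ?sum0//.
have -> : \sum_i (tnth x i - tnth z i) ^+ 2 =
    \sum_i a i ^+ 2 + 2 * (\sum_i a i * b i) + \sum_i b i ^+ 2.
  rewrite mulr_sumr -!big_split /=; apply: eq_bigr => i _.
  by rewrite /a /b; ring.
suff : \sum_i a i * b i <= edist x y * edist y z by rewrite mulr2n; lra.
apply: le_trans (ler_norm _) _.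
rewrite -sqrtr_sqr /edist -sqrtrM; last exact: sum0.
by rewrite ler_sqrt ?mulr_ge0 ?sum0//; exact: sum_mul_sqr_le.
Qed.

Lemma ler_coord_edist x y i : `|tnth x i - tnth y i| <= edist x y.
Proof.
rewrite -sqrtr_sqr ler_sqrt; last by apply: sumr_ge0 => j _; exact: sqr_ge0.
rewrite (bigD1 i)//= lerDl; apply: sumr_ge0 => j _; exact: sqr_ge0.
Qed.

Lemma edist_le_sup x y (h : R) : 0 <= h ->
  (forall i, `|tnth x i - tnth y i| <= h) -> edist x y <= n%:R * h.
Proof.
move=> h0 xy; rewrite -[leRHS]ger0_norm ?mulr_ge0// -sqrtr_sqr ler_sqrt ?sqr_ge0//.
apply: (@le_trans _ _ (\sum_(i < n) h ^+ 2)).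
  apply: ler_sum => i _.
  by rewrite -[leLHS]real_normK ?num_real// ler_pXn2r ?nnegrE.
rewrite sumr_const card_ord -[leLHS]mulr_natl exprMn ler_wpM2r ?sqr_ge0//.
by rewrite -natrX ler_nat; case: (n) => // k; rewrite -[leqLHS]muln1 leq_pmul2l.
Qed.

Definition seg x y (t : R) : n.-tuple R :=
  [tuple tnth x i + t * (tnth y i - tnth x i) | i < n].

Lemma seg0 x y : seg x y 0 = x.
Proof. by apply: eq_from_tnth => i; rewrite tnth_mktuple mul0r addr0. Qed.

Lemma seg1 x y : seg x y 1 = y.
Proof. by apply: eq_from_tnth => i; rewrite tnth_mktuple; ring. Qed.

Lemma edist_seg x y a b : edist (seg x y a) (seg x y b) = `|a - b| * edist x y.
Proof.
rewrite -sqrtr_sqr /edist -sqrtrM ?sqr_ge0//; congr Num.sqrt.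
rewrite mulr_sumr; apply: eq_bigr => i _; rewrite !tnth_mktuple; ring.
Qed.

Lemma edist_eq0 x y : edist x y = 0 -> x = y.
Proof.
move=> xy; apply: eq_from_tnth => i; apply/eqP.
by rewrite -subr_eq0 -normr_le0 -xy ler_coord_edist.
Qed.

Lemma eopen_box (e h : 'I_n -> R) :
  eopen [set x | forall i, `|tnth x i - e i| < h i].
Proof.
move=> x xB.
pose r := \big[Num.min/1]_(i < n) (h i - `|tnth x i - e i|).
exists r.
  by apply: lt_bigmin => // i _; rewrite subr_gt0.
move=> y; rewrite /eball /= => xy i.
have ri : r <= h i - `|tnth x i - e i| by exact: bigmin_le.
have := ler_coord_edist x y i.
have := ler_distD (tnth x i) (tnth y i) (e i).
rewrite (distrC (tnth y i) (tnth x i)); lra.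
Qed.

Lemma boundary_notin (U : set (n.-tuple R)) x : eopen U -> boundary U x -> ~ U x.
Proof.
move=> oU bx /oU[r r0 rU]; have [_ [y [nUy xy]]] := bx _ r0.
exact/nUy/rU.
Qed.

(** The exit time is the supremum [T] of the times up to which the curve has stayed in [U]. At [T]
    it is outside [U], since openness would let it stay longer, and just before [T] it is inside;
    the Lipschitz bound serves as continuity. *)
Lemma curve_exit (U : set (n.-tuple R)) (gamma : R -> n.-tuple R) (l : R) :
  0 <= l -> eopen U ->
  (forall a b, 0 <= a -> a <= b -> b <= l -> edist (gamma a) (gamma b) <= b - a) ->
  U (gamma 0) -> ~ U (gamma l) ->
  exists t, [/\ 0 <= t, t <= l & boundary U (gamma t)].
Proof.
move=> l0 oU lip U0 Ul.
pose S := [set t : R | 0 <= t <= l /\ forall s, 0 <= s -> s <= t -> U (gamma s)].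
have S0 : S 0.
  split; first by rewrite lexx.
  by move=> s s0 sle0; have -> : s = 0 by apply/eqP; rewrite eq_le sle0.
have ubS : ubound S l by move=> t [/andP[]].
have supS : has_sup S by split; [exists 0|exists l].
set T := sup S.
have T0 : 0 <= T by apply: ub_le_sup => //; exists l.
have Tl : T <= l by apply: ge_sup => //; exists 0.
have below s : 0 <= s -> s < T -> U (gamma s).
  move=> s0 sT; have Ts : 0 < T - s by rewrite subr_gt0.
  have [t St st] := sup_adherent Ts supS.
  by apply St.2 => //; move: st; rewrite -/T; lra.
exists T; split=> // r r0.
have UT : ~ U (gamma T).
  move=> UT; have [e e0 eU] := oU _ UT.
  have Tltl : T < l.
    by rewrite lt_neqAle Tl andbT; apply/eqP => TE; apply: Ul; rewrite -TE.
  pose d := Num.min (e / 2) (l - T).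
  have d0 : 0 < d by rewrite lt_min subr_gt0 Tltl andbT divr_gt0.
  have de : d <= e / 2 by rewrite ge_min lexx.
  have dl : d <= l - T by rewrite ge_min lexx orbT.
  suff : T + d <= T by lra.
  apply: ub_le_sup; first by exists l.
  split; first by apply/andP; split; lra.
  move=> s s0 sTd; have [/below|Ts] := ltP s T; first exact.
  by apply: eU; rewrite /eball /=; have := lip T s T0 Ts ltac:(lra); lra.
split; last by exists (gamma T); rewrite edistxx.
have Tpos : 0 < T.
  by rewrite lt_neqAle T0 andbT; apply/eqP => TE; apply: UT; rewrite -TE.
pose s := Num.max 0 (T - r / 2).
have s0 : 0 <= s by rewrite le_max lexx.
have sr : T - r / 2 <= s by rewrite le_max lexx orbT.
have sT : s < T by rewrite gt_max Tpos /=; lra.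
exists (gamma s); split; first exact: below.
by rewrite edistC; have := lip s T s0 (ltW sT) Tl; lra.
Qed.

Lemma seg_exit (U : set (n.-tuple R)) x y : eopen U -> U x -> ~ U y ->
  exists t, [/\ 0 <= t, t <= 1 & boundary U (seg x y t)].
Proof.
move=> oU Ux Uy; set l := edist x y.
have l0 : 0 < l.
  rewrite lt_neqAle edist_ge0 andbT; apply/eqP => /esym /edist_eq0 xy.
  by apply: Uy; rewrite -xy.
have [|||t [t0 tl bt]] := @curve_exit U (fun t => seg x y (t / l)) l (ltW l0) oU.
- move=> a b a0 ab bl; rewrite edist_seg -mulrBl normrM normfV (gtr0_norm l0).
  by rewrite mulfVK ?gt_eqF// distrC ger0_norm ?subr_ge0.
- by rewrite mul0r seg0.
- by rewrite divff ?gt_eqF// seg1.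
- exists (t / l); split => //; first by rewrite divr_ge0// ltW.
  by rewrite ler_pdivrMr// mul1r.
Qed.

(** The segment towards a point of the complement meets the boundary, so later estimates only have
    to exhibit points outside [G]. *)
Lemma dist_boundary_le (G : set (n.-tuple R)) x y : eopen G -> G x -> ~ G y ->
  dist_set x (boundary G) <= edist x y.
Proof.
move=> oG Gx Gy; have [t [t0 t1 bt]] := seg_exit oG Gx Gy.
apply: (@le_trans _ _ (edist x (seg x y t))).
  apply: ge_inf; last by exists (seg x y t).
  by exists 0 => _ [z _ <-]; exact: edist_ge0.
rewrite -{1}(seg0 x y) edist_seg sub0r normrN ger0_norm//.
by rewrite ler_piMl// edist_ge0.
Qed.

(** The infimum of the empty set is 0, hence the nonempty boundary. *)
Lemma dist_boundary_ge (G : set (n.-tuple R)) x (r : R) : boundary G !=set0 ->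
  eopen G -> eball x r `<=` G -> r <= dist_set x (boundary G).
Proof.
move=> [z bz] oG rG; apply: lb_le_inf; first by exists (edist x z); exists z.
move=> _ [w bw <-]; rewrite leNgt; apply/negP => wr.
exact: (boundary_notin oG bw (rG _ wr)).
Qed.

Lemma eball_dist_boundary (G : set (n.-tuple R)) x : eopen G -> G x ->
  eball x (dist_set x (boundary G)) `<=` G.
Proof.
move=> oG Gx y xy; apply: contrapT => Gy.
by have := dist_boundary_le oG Gx Gy; rewrite leNgt xy.
Qed.

End EuclideanDistance.

(** * Curves parametrised by arc length *)

Section CurveLength.
Context {R : realType} {n : nat}.
Implicit Types (x y z : n.-tuple R) (gamma : R -> n.-tuple R).

Definition exact_partition gamma (a b : R) : Prop :=
  exists (k : nat) (t : nat -> R),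
    [/\ t 0%N = a, t k = b, (forall i, (i < k)%N -> t i <= t i.+1) &
        \sum_(i < k) edist (gamma (t i)) (gamma (t i.+1)) = b - a].

(** A certificate of arc length for polygonal curves: the Lipschitz bound controls every inscribed
    polygon from above, and one partition attains [b - a]. Both halves survive concatenation. *)
Definition unit_speed gamma (l : R) : Prop :=
  forall a b, 0 <= a -> a <= b -> b <= l ->
    edist (gamma a) (gamma b) <= b - a /\ exact_partition gamma a b.

Lemma partition_le (k : nat) (t : nat -> R) :
  (forall i, (i < k)%N -> t i <= t i.+1) ->
  forall i j, (i <= j)%N -> (j <= k)%N -> t i <= t j.
Proof.
move=> tt i; elim=> [|j IH]; first by rewrite leqn0 => /eqP ->.
rewrite leq_eqVlt ltnS => /orP[/eqP -> //|ij] jk.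
by apply: le_trans (IH ij (ltnW jk)) (tt _ jk).
Qed.

Lemma unit_speed_arclength gamma l : 0 <= l -> unit_speed gamma l ->
  arclength_param gamma l.
Proof.
move=> l0 us; split=> // a b a0 ab bl; apply/eqP; rewrite eq_le; apply/andP; split.
  apply: ge_ereal_sup => _ [k [t [t0 tk tt ->]]]; rewrite lee_fin.
  have tle := partition_le tt.
  apply: (@le_trans _ _ (\sum_(i < k) (t i.+1 - t i))).
    apply: ler_sum => i _; apply: (us _ _ _ _ _).1.
    - by apply: le_trans a0 _; rewrite -t0; apply: tle => //; exact: ltnW.
    - exact: tt.
    - by apply: le_trans bl; rewrite -tk; exact: tle.
  by rewrite -(big_mkord xpredT (fun i => t i.+1 - t i)) telescope_sumr// t0 tk.
have [k [t [t0 tk tt ts]]] := (us a b a0 ab bl).2.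
by apply: ereal_sup_ubound; exists k, t; rewrite ts.
Qed.

Lemma exact_partition_cat gamma a c b :
  exact_partition gamma a c -> exact_partition gamma c b ->
  exact_partition gamma a b.
Proof.
move=> [k1 [t1 [a1 c1 m1 s1]]] [k2 [t2 [c2 b2 m2 s2]]].
pose t i := if (i <= k1)%N then t1 i else t2 (i - k1)%N.
have tl i : (i <= k1)%N -> t i = t1 i by rewrite /t => ->.
have tr i : t (k1 + i)%N = t2 i.
  rewrite /t; case: ltnP => [ik|]; first by rewrite addKn.
  by rewrite -{2}(addn0 k1) leq_add2l leqn0 => /eqP ->; rewrite addn0 c1 c2.
exists (k1 + k2)%N, t; split.
- by rewrite tl.
- by rewrite tr.
- move=> i ik; have [ik1|k1i] := ltnP i k1; first by rewrite !tl// ?m1// ltnW.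
  have -> : i = (k1 + (i - k1))%N by rewrite subnKC.
  by rewrite -addnS !tr m2// ltn_subLR.
- rewrite big_split_ord /= -[RHS](_ : (c - a) + (b - c) = _); last by ring.
  rewrite -s1 -s2; congr (_ + _); apply: eq_bigr => i _.
    by rewrite !tl// ltnW.
  by rewrite -addnS !tr.
Qed.

Lemma exact_partition_shift gamma gamma' (s a b : R) :
  (forall u, a <= u -> u <= b -> gamma (u + s) = gamma' u) ->
  exact_partition gamma' a b -> exact_partition gamma (a + s) (b + s).
Proof.
move=> e [k [t [t0 tk tt ts]]]; exists k, (fun i => t i + s); split.
- by rewrite t0.
- by rewrite tk.
- by move=> i ik; rewrite lerD2r tt.
- rewrite (_ : b + s - (a + s) = b - a); last by ring.
  rewrite -ts; apply: eq_bigr => i _.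
  have tle := partition_le tt.
  by rewrite !e// -?t0 -?tk; apply: tle => //; exact: ltnW.
Qed.

Lemma unit_speed_cat gamma1 gamma2 l1 l2 : 0 <= l1 -> 0 <= l2 ->
  gamma1 l1 = gamma2 0 -> unit_speed gamma1 l1 -> unit_speed gamma2 l2 ->
  unit_speed (fun t => if t <= l1 then gamma1 t else gamma2 (t - l1)) (l1 + l2).
Proof.
move=> l10 l20 e us1 us2; set gamma := fun t : R => _.
have gl t : t <= l1 -> gamma t = gamma1 t by rewrite /gamma => ->.
have gr t : 0 <= t -> gamma (t + l1) = gamma2 t.
  move=> t0; rewrite /gamma; case: ltP => tl; first by rewrite addrK.
  have -> : t = 0 by lra.
  by rewrite add0r.
have left a b : 0 <= a -> a <= b -> b <= l1 ->
    edist (gamma a) (gamma b) <= b - a /\ exact_partition gamma a b.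
  move=> a0 ab bl; have [h1 h2] := us1 a b a0 ab bl; split.
    by rewrite !gl// (le_trans ab).
  rewrite -[a]addr0 -[b]addr0; apply: exact_partition_shift h2 => u _ ub.
  by rewrite addr0 gl// (le_trans ub).
have right a b : 0 <= a -> a <= b -> b <= l2 ->
    edist (gamma (a + l1)) (gamma (b + l1)) <= b - a /\
    exact_partition gamma (a + l1) (b + l1).
  move=> a0 ab bl; have [h1 h2] := us2 a b a0 ab bl; split.
    by rewrite !gr// (le_trans a0).
  apply: exact_partition_shift h2 => u au _.
  by rewrite gr// (le_trans a0).
move=> a b a0 ab bl; have [bl1|l1b] := leP b l1; first exact: left.
have [l1a|al1] := leP l1 a.
  have := right (a - l1) (b - l1); rewrite !subrK.
  rewrite (_ : b - l1 - (a - l1) = b - a); last by ring.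
  by apply; lra.
have [h1 h2] := left a l1 a0 (ltW al1) (lexx _).
have := right 0 (b - l1); rewrite subrK add0r subr0 => -[|||h3 h4]; [lra|lra|lra|].
split; last exact: exact_partition_cat h2 h4.
by have := edist_triangle (gamma l1) (gamma a) (gamma b); lra.
Qed.

Lemma unit_speed_seg x y :
  unit_speed (fun t => seg x y (t / edist x y)) (edist x y).
Proof.
set l := edist x y => a b a0 ab bl.
have lab : edist (seg x y (a / l)) (seg x y (b / l)) = b - a.
  have [l00|l0] := eqVneq l 0.
    have -> : b = a by move: (bl); rewrite l00; lra.
    by rewrite edistxx subrr.
  have lp : 0 < l by rewrite lt_neqAle eq_sym l0 edist_ge0.
  rewrite edist_seg -mulrBl normrM normfV (gtr0_norm lp) mulfVK//.
  by rewrite distrC ger0_norm ?subr_ge0.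
split; first by rewrite lab.
exists 1%N, (fun i => if i == 0%N then a else b); split => //.
  by case.
by rewrite big_ord_recl big_ord0 /= addr0 lab.
Qed.

End CurveLength.

Section JohnPath.
Context {R : realType} {n : nat}.
Variables (G : set (n.-tuple R)) (r : R -> R).
Implicit Types (x y z : n.-tuple R).

(* [r] is the clearance required after arc length [t]; [t0] is the length
   already travelled when the path starts. *)
Definition jpath x y (t0 l : R) : Prop :=
  0 <= l /\ exists gamma, [/\ unit_speed gamma l, gamma 0 = x, gamma l = y &
    forall t, 0 <= t -> t <= l ->
      G (gamma t) /\ eball (gamma t) (r (t0 + t)) `<=` G].

Lemma jpath_cat y x z t0 l1 l2 :
  jpath x y t0 l1 -> jpath y z (t0 + l1) l2 -> jpath x z t0 (l1 + l2).
Proof.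
move=> [l10 [g1 [us1 g10 g1l G1]]] [l20 [g2 [us2 g20 g2l G2]]].
split; first exact: addr_ge0.
exists (fun t => if t <= l1 then g1 t else g2 (t - l1)); split.
- by apply: unit_speed_cat => //; rewrite g1l.
- by rewrite l10.
- case: ifPn => [l12|_]; last by rewrite addrC addKr.
  have l200 : l2 = 0 by lra.
  by rewrite -g2l l200 addr0 g1l g20.
- move=> t t0' tl; case: leP => [/G1|tl1]; first exact.
  have := G2 (t - l1); rewrite -addrA (addrCA l1) subrr addr0.
  by apply; lra.
Qed.

Hypothesis r_mono : forall a b, 0 <= a -> a <= b -> r a <= r b.

(** A longer past demands more clearance, so a path built for the worst length already travelled
    also serves after a shorter one. *)
Lemma jpath_le x y t0 t1 l : 0 <= t0 -> t0 <= t1 ->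
  jpath x y t1 l -> jpath x y t0 l.
Proof.
move=> t00 t01 [l0 [g [us g0 gl Gg]]]; split=> //; exists g; split=> // t t0' tl.
have [Gt bt] := Gg t t0' tl; split=> // w; rewrite /eball /= => gw; apply: bt.
apply: lt_le_trans gw _; apply: r_mono; lra.
Qed.

Lemma jpath_seg x y t0 :
  (forall th, 0 <= th -> th <= 1 -> G (seg x y th) /\
    eball (seg x y th) (r (t0 + th * edist x y)) `<=` G) ->
  jpath x y t0 (edist x y).
Proof.
move=> H; split; first exact: edist_ge0.
exists (fun t => seg x y (t / edist x y)); split.
- exact: unit_speed_seg.
- by rewrite mul0r seg0.
- have [xy|xy] := eqVneq (edist x y) 0; last by rewrite divff// seg1.
  by rewrite xy mul0r seg0; exact: edist_eq0.
- move=> t t0' tl; have [xy|xy] := eqVneq (edist x y) 0.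
    have -> : t = 0 by lra.
    by have := H 0; rewrite !mul0r; apply.
  have xyp : 0 < edist x y by rewrite lt_neqAle eq_sym xy edist_ge0.
  have := H (t / edist x y); rewrite mulfVK//; apply.
    by rewrite divr_ge0// edist_ge0.
  by rewrite ler_pdivrMr// mul1r.
Qed.

Lemma jpath_refl x t0 : G x -> eball x (r t0) `<=` G -> jpath x x t0 0.
Proof.
move=> Gx xG; have := @jpath_seg x x t0; rewrite edistxx; apply => th _ _.
have -> : seg x x th = x.
  by apply: eq_from_tnth => i; rewrite tnth_mktuple subrr mulr0 addr0.
by rewrite mulr0 addr0.
Qed.

End JohnPath.

(** * The domain *)

Section CantorWords.
Context {R : realType}.
Variable kap : R.
Hypotheses (kap0 : 0 < kap) (kap12 : kap < 2^-1).

(* The centre of the Cantor interval, of length [kap ^+ size w], which is reached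
   from the unit interval around 0 by the choices of half recorded in [w]. *)
Fixpoint ctr (w : seq bool) : R :=
  if w is b :: v then (if b then 4^-1 else - 4^-1) + kap * ctr v else 0.

(** The subintervals of the unit interval have centres 1/4 and -1/4 and length [kap], so they keep
    the distance 1/4 - kap/2 from 0: half the length of the removed middle interval. *)
Definition gap : R := (1 - 2 * kap) / 4.

Lemma gap_gt0 : 0 < gap. Proof. by move: kap0 kap12; rewrite /gap; lra. Qed.

Lemma gap_le : gap <= 4^-1. Proof. by move: kap0 kap12; rewrite /gap; lra. Qed.

Lemma kapX_gt0 j : 0 < kap ^+ j. Proof. exact: exprn_gt0. Qed.

Lemma kapX_le1 j : kap ^+ j <= 1. Proof. by move: kap0 kap12 => *; apply: exprn_ile1; lra. Qed.

Lemma kapX_le i j : (i <= j)%N -> kap ^+ j <= kap ^+ i.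
Proof. by move: kap0 kap12 => k0 k12 ij; apply: ler_wiXn2l => //; lra. Qed.

Lemma ctr_le w : `|ctr w| <= 2^-1.
Proof.
have k0 := kap0; have k12 := kap12.
elim: w => [|b w IH] /=; first by rewrite normr0 invr_ge0.
have : `|kap * ctr w| <= 4^-1.
  rewrite normrM (gtr0_norm kap0).
  by apply: le_trans (ler_pM _ _ (ltW kap12) IH) _ => //; [exact: ltW|lra].
by case: b; rewrite !ler_norml; lra.
Qed.

Lemma ctr_cat w v : ctr (w ++ v) = ctr w + kap ^+ size w * ctr v.
Proof.
have k0 := kap0; have k12 := kap12.
elim: w => [|b w IH] /=; first by rewrite expr0; ring.
by rewrite IH exprS; ring.
Qed.

Lemma ctr_take j w : (j <= size w)%N ->
  `|ctr w - ctr (take j w)| <= kap ^+ j / 2.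
Proof.
have k0 := kap0; have k12 := kap12.
move=> jw; rewrite -{1}(cat_take_drop j w) ctr_cat addrC addKr size_takel//.
by rewrite normrM (gtr0_norm (kapX_gt0 j)) ler_pM2l ?kapX_gt0// ctr_le.
Qed.

Lemma ctr_parent j w : size w = j.+1 ->
  `|ctr w - ctr (take j w)| = kap ^+ j / 4.
Proof.
have k0 := kap0; have k12 := kap12.
move=> sw; rewrite -{1}(cat_take_drop j w) ctr_cat addrC addKr size_takel ?sw//.
rewrite normrM (gtr0_norm (kapX_gt0 j)); congr (_ * _).
have : size (drop j w) = 1%N by rewrite size_drop sw subSnn.
case: (drop j w) => [|b [|]]//= _; rewrite mulr0 addr0.
by case: b; rewrite ?normrN gtr0_norm ?invr_gt0.
Qed.

(** A common prefix only rescales by [kap]. After it, either one word has ended and the other centre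
    is at least [gap] away from the middle, or the words choose different halves, which are
    [2 * gap] apart. *)
Lemma ctr_sep w v : w <> v ->
  gap * kap ^+ minn (size w) (size v) <= `|ctr w - ctr v|.
Proof.
have k0 := kap0; have k12 := kap12.
have g0 := gap_gt0.
have nil b u : gap <= `|ctr (b :: u)|.
  have : `|kap * ctr u| <= kap / 2.
    by rewrite normrM (gtr0_norm kap0) ler_pM2l// ctr_le.
  case: b => /=; rewrite ler_norml ler_normr /gap => /andP[h1 h2].
    by apply/orP; left; lra.
  by apply/orP; right; lra.
elim: w v => [|b w IH] [|b' v]//=.
- by move=> _; rewrite min0n expr0 mulr1 sub0r normrN nil.
- by move=> _; rewrite minn0 expr0 mulr1 subr0 nil.
move=> wv; rewrite minnSS exprS.
have [bb|bb] := eqVneq b b'.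
  have wv2 : w <> v by move=> e; apply: wv; rewrite bb e.
  rewrite bb opprD addrACA subrr add0r -mulrBr normrM (gtr0_norm kap0).
  by rewrite mulrCA ler_pM2l// IH.
apply: (@le_trans _ _ gap).
  rewrite ler_piMr ?(ltW g0)// -[leRHS]mulr1.
  by apply: ler_pM => //; [exact: ltW|exact/ltW/kapX_gt0|lra|exact: kapX_le1].
have [h1 h2] : `|kap * ctr w| <= kap / 2 /\ `|kap * ctr v| <= kap / 2.
  by split; rewrite normrM (gtr0_norm kap0) ler_pM2l// ctr_le.
move: h1 h2; rewrite !ler_norml ler_normr /gap => /andP[h1 h2] /andP[h3 h4].
by apply/orP; case: b b' bb {wv} => -[]// _; [left|right]; lra.
Qed.

(** Each radius is at most half the separation in [ctr_sep], which is governed by the shorter word.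
    Words of different lengths are included, so the cores of all generations are disjoint at
    once. *)
Lemma core_uniq (y : R) w v :
  `|y - ctr w| < gap / 2 * kap ^+ size w ->
  `|y - ctr v| < gap / 2 * kap ^+ size v -> w = v.
Proof.
have k0 := kap0; have k12 := kap12.
move=> yw yv; apply: contrapT => /ctr_sep.
have g0 := gap_gt0.
have := ler_distD y (ctr w) (ctr v); rewrite (distrC (ctr w) y) => tri.
have : kap ^+ size w <= kap ^+ minn (size w) (size v).
  exact/kapX_le/geq_minl.
have : kap ^+ size v <= kap ^+ minn (size w) (size v).
  exact/kapX_le/geq_minr.
rewrite -(ler_pM2l g0) => hv; rewrite -(ler_pM2l g0) => hw.
by move: yw yv; rewrite !(mulrAC _ (2^-1)); lra.
Qed.

End CantorWords.

Section Domain.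
Context {R : realType} {m : nat}.
Local Notation n := m.+2.
Variables kap s alpha : R.

(** The unit for tubes and rooms: [4 * unitq] is the core radius of [core_uniq], while a tube ends
    at [3 / 2 * unitq] from the cell centre, in the scale of the cell. *)
Definition unitq : R := gap kap / 8.

Definition admissible : Prop :=
  [/\ 0 < kap, kap < 2^-1, 1 < s, 0 < alpha & alpha <= unitq / 16].

Hypothesis par : admissible.

Local Notation q := unitq.
Local Notation K j := (kap ^+ j).
Local Notation index := {ffun 'I_n -> seq bool}.

Definition cell (j : nat) (w : index) : Prop := forall i, size (w i) = j.

Definition tube_width (j : nat) : R := alpha * K j `^ s.

(* The pieces of kind 0, 1, 2, 3 are the plate, the arm reaching the plate of
   the parent cell, the narrow tube and the room that the tube crosses. *)
Definition pcenter (k j : nat) (w : index) (i : 'I_n) : R :=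
  ctr kap (w i) + (if (k < 2)%N then 0 else q / 2 * K j).

(** On the zeroth axis, seen from the cell centre in units of [q * K j], the plate covers -1/16 to
    1/16, the room 1/4 to 3/4 and the tube -1/2 to 3/2, so the tube pierces both. The half-length of
    the arm is half the size of the parent cell, twice the distance to the parent centre along this
    axis. *)
Definition phalf (k j : nat) (i : 'I_n) : R :=
  match k with
  | 0 => if i == ord0 then q / 16 * K j else K j / 2
  | 1 => if i == ord0 then K j / (2 * kap) else q / 16 * K j
  | 2 => if i == ord0 then q * K j else tube_width j
  | _ => q / 4 * K j
  end.

Definition piece k j w : set (n.-tuple R) := box (pcenter k j w) (phalf k j).

Definition apartments : set (n.-tuple R) :=
  [set x | exists k j w, cell j w /\ piece k j w x].

Local Notation G := apartments.

Lemma q_gt0 : 0 < q.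
Proof. by have [k0 k12 _ _ _] := par; rewrite /unitq divr_gt0// gap_gt0. Qed.

Lemma q_le : q <= 32^-1.
Proof.
by have [k0 k12 _ _ _] := par; rewrite /unitq; have := gap_le k0 k12; lra.
Qed.

Lemma K_gt0 j : 0 < K j.
Proof. by have [k0 _ _ _ _] := par; exact: kapX_gt0. Qed.

Lemma K_le1 j : K j <= 1.
Proof. by have [k0 k12 _ _ _] := par; exact: kapX_le1. Qed.

Lemma width_gt0 j : 0 < tube_width j.
Proof.
by have [_ _ _ a0 _] := par; rewrite mulr_gt0// powR_gt0// K_gt0.
Qed.

Lemma KpowR_le j : K j `^ s <= K j.
Proof.
by have [_ _ s1 _ _] := par; apply: ge1r_powR; [rewrite K_gt0 K_le1|exact: ltW].
Qed.

Lemma width_le j : tube_width j <= alpha * K j.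
Proof. by have [_ _ _ a0 _] := par; rewrite ler_pM2l// KpowR_le. Qed.

(** The tube width decides. The spare factor [kap] pays for measuring an arm of generation j+1 in
    the scale [K j], as [jpath_climb] does. *)
Lemma phalf_ge k j i : alpha * kap * K j `^ s <= phalf k j i.
Proof.
have [kap0 kap12 s1 alpha0 alphaq] := par.
have K0 := K_gt0 j; have q0 := q_gt0; have ql := q_le.
have h : alpha * kap * K j `^ s <= q / 16 * K j.
  apply: ler_pM => //; [|exact: powR_ge0| |exact: KpowR_le].
    by rewrite mulr_ge0// ltW.
  by apply: le_trans alphaq; rewrite ler_piMr// ?ltW//; lra.
have kK : K j / 2 <= K j / (2 * kap).
  by rewrite ler_pM2l// lef_pV2 ?posrE ?mulr_gt0//; lra.
have qK : q * K j <= 32^-1 * K j by rewrite ler_pM2r.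
have qK0 : 0 < q * K j by rewrite mulr_gt0.
case: k => [|[|[|k]]] /=; try case: ifP => _; try by move: h kK qK qK0; lra.
rewrite /tube_width; apply: ler_wpM2r; first exact: powR_ge0.
by rewrite ler_piMr// ltW//; lra.
Qed.

Lemma phalf_gt0 k j i : 0 < phalf k j i.
Proof.
have [kap0 _ _ alpha0 _] := par; apply: lt_le_trans (phalf_ge k j i).
by rewrite !mulr_gt0// powR_gt0// K_gt0.
Qed.

Lemma phalf_le k j i : phalf k j i <= K j / (2 * kap).
Proof.
have [kap0 kap12 s1 alpha0 alphaq] := par.
have K0 := K_gt0 j; have q0 := q_gt0; have ql := q_le.
have kK : K j <= K j / (2 * kap).
  by rewrite ler_pdivlMr ?mulr_gt0// ger_pMr//; lra.
have qK : q * K j <= 32^-1 * K j by rewrite ler_pM2r.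
have qK0 : 0 < q * K j by rewrite mulr_gt0.
have aK : alpha * K j <= 16^-1 * (q * K j).
  by rewrite mulrA ler_pM2r// mulrC.
have wK := width_le j.
by case: k => [|[|[|k]]] /=; try case: ifP => _ //; move: qK qK0 aK wK kK; lra.
Qed.

Lemma piece_sub k j w : cell j w -> piece k j w `<=` G.
Proof. by move=> cw x px; exists k, j, w. Qed.

Lemma apartments_open : eopen G.
Proof.
move=> x [k [j [w [cw px]]]]; have [e e0 eb] := eopen_box px.
by exists e => // y /eb; exact: piece_sub.
Qed.

End Domain.

(** * John curves in the domain *)

(** Convexity: the box contains the cube of half-side [rho] about its centre, hence also the average
    of [x] and this cube with weights [1 - th] and [th]. *)
Lemma box_cone {R : realType} {n : nat} (e h : 'I_n -> R) (rho : R) x th :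
  (forall i, rho <= h i) -> box e h x -> 0 <= th -> th <= 1 ->
  box e h (seg x (mktuple e) th) /\
  eball (seg x (mktuple e) th) (th * rho) `<=` box e h.
Proof.
move=> rh xB th0 th1.
have pe i : `|tnth (seg x (mktuple e) th) i - e i| = (1 - th) * `|tnth x i - e i|.
  rewrite !tnth_mktuple.
  rewrite (_ : _ - e i = (1 - th) * (tnth x i - e i)); last by ring.
  by rewrite normrM ger0_norm ?subr_ge0.
split=> [i|y xy i].
  by rewrite pe; apply: le_lt_trans (xB i); rewrite ler_piMl//; lra.
move: xy; rewrite /eball /= => xy.
have := ler_coord_edist (seg x (mktuple e) th) y i; rewrite distrC => yp.
have := ler_distD (tnth (seg x (mktuple e) th) i) (tnth y i) (e i).
have := ler_wpM2l (_ : 0 <= 1 - th) (ltW (xB i)); rewrite subr_ge0 => /(_ th1).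
have := ler_wpM2l th0 (rh i).
by rewrite pe; lra.
Qed.

Lemma eball_sub_box {R : realType} {n : nat} (e h : 'I_n -> R) (rho : R) p :
  (forall i, `|tnth p i - e i| + rho <= h i) -> eball p rho `<=` box e h.
Proof.
move=> H y; rewrite /eball /= => py i.
have := ler_coord_edist p y i; rewrite distrC => yp.
have := ler_distD (tnth p i) (tnth y i) (e i).
by have := H i; lra.
Qed.

Section JohnElbow.
Context {R : realType} {m : nat}.
Local Notation n := m.+2.
Variables kap s alpha : R.
Hypothesis par : admissible kap s alpha.

Local Notation q := (unitq kap).
Local Notation K j := (kap ^+ j).
Local Notation index := {ffun 'I_n -> seq bool}.
Local Notation G := (@apartments R m kap s alpha).

(** The budget: on arrival at the centre of a cell of generation j the path is no longer than
    [john_reach * K j]. A step from generation j+1 to j may cost [n%:R * K j], because kap (1/kap +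
    2) + 1 <= 1/kap + 2. *)
Definition john_reach : R := n%:R * (kap^-1 + 2).

(** The first summand brings the clearance required after a length [john_reach * K j] below
    [alpha * kap] times the s-th power of [K j]; the second bounds the total length. *)
Definition john_const : R := john_reach `^ s / (alpha * kap) + john_reach.

Definition john_clearance (t : R) : R := t `^ s / john_const.

Lemma n_ge1 : 1 <= n%:R :> R. Proof. by rewrite ler1n. Qed.

Lemma kapV_ge2 : 2 < kap^-1.
Proof.
have [kap0 kap12 _ _ _] := par.
by rewrite -[ltLHS]invrK ltf_pV2 ?posrE.
Qed.

Lemma reach_gt0 : 0 < john_reach.
Proof.
have := n_ge1; have := kapV_ge2 => k2 n1; apply: mulr_gt0; lra.
Qed.

Lemma jconst_gt0 : 0 < john_const.
Proof.
have [kap0 _ _ alpha0 _] := par.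
by rewrite addr_gt0 ?reach_gt0// divr_gt0 ?mulr_gt0// powR_gt0// reach_gt0.
Qed.

Lemma clearance_mono a b : 0 <= a -> a <= b -> john_clearance a <= john_clearance b.
Proof.
have [_ _ s1 _ _] := par.
move=> a0 ab; rewrite ler_pM2r ?invr_gt0 ?jconst_gt0//.
by apply: ge0_ler_powR; rewrite ?nnegrE//; lra.
Qed.

Lemma clearance_le j t : 0 <= t -> t <= john_reach * K j ->
  john_clearance t <= alpha * kap * K j `^ s.
Proof.
have [kap0 _ s1 alpha0 _] := par; have K0 := K_gt0 par j.
move=> t0 tr; apply: le_trans (clearance_mono t0 tr) _.
have r0 := reach_gt0.
rewrite /john_clearance powRM ?(ltW r0) ?(ltW K0)// (mulrAC _ (K j `^ s)).
rewrite ler_wpM2r ?powR_ge0//.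
rewrite ler_pdivrMr ?jconst_gt0// /john_const mulrDr mulrC divfK.
  by rewrite lerDl; apply: mulr_ge0; [apply: mulr_ge0|]; exact: ltW.
by rewrite gt_eqF// mulr_gt0.
Qed.

(** As s >= 1, th^s <= th: the linear gain of clearance in [box_cone] dominates the required
    power. *)
Lemma clearance_cone j th t : 0 <= th -> th <= 1 -> 0 <= t -> t <= john_reach * K j ->
  john_clearance (th * t) <= th * (alpha * kap * K j `^ s).
Proof.
have [_ _ s1 _ _] := par.
move=> th0 th1 t0 tr; have [->|thN0] := eqVneq th 0.
  by rewrite !mul0r /john_clearance powR0 ?mul0r//; lra.
have thp : 0 < th by rewrite lt_def thN0.
apply: (@le_trans _ _ (th * john_clearance t)).
  rewrite /john_clearance mulrA ler_pM2r ?invr_gt0 ?jconst_gt0//.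
  by apply: ge1r_powRZ => //; [rewrite thp|exact: ltW].
by rewrite ler_pM2l// clearance_le.
Qed.

Lemma jpath_to_center k j (w : index) x : cell j w -> piece kap s alpha k j w x ->
  exists l, l <= n%:R * (K j / (2 * kap)) /\
    jpath G john_clearance x (mktuple (pcenter kap k j w)) 0 l.
Proof.
have [kap0 kap12 s1 alpha0 alphaq] := par; have K0 := K_gt0 par j.
move=> cw px; set e := mktuple _; exists (edist x e).
have xe : edist x e <= n%:R * (K j / (2 * kap)).
  apply: edist_le_sup => [|i].
    by rewrite divr_ge0 ?mulr_ge0// ltW.
  rewrite tnth_mktuple; apply: le_trans (ltW (px i)) _.
  exact: phalf_le.
split=> //; apply: jpath_seg => th th0 th1.
have rh (i : 'I_n) : alpha * kap * K j `^ s <= phalf kap s alpha k j i by exact: phalf_ge.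
have [b1 b2] := box_cone rh px th0 th1; split; first exact: (piece_sub cw b1).
move=> y; rewrite /eball /= add0r => ey; apply: (piece_sub cw); apply: b2.
apply: lt_le_trans ey _; apply: clearance_cone => //; first exact: edist_ge0.
apply: le_trans xe _; rewrite /john_reach -mulrA ler_wpM2l//.
rewrite (_ : K j / (2 * kap) = kap^-1 / 2 * K j); last by field; rewrite gt_eqF.
by rewrite ler_pM2r//; have := kapV_ge2; lra.
Qed.

(* First along the long axis of the box until the zeroth coordinate is that of
   the cell centre, then inside the plate. *)
Lemma jpath_elbow (e h : 'I_n -> R) j (w : index) t0 (rho : R) :
  box e h `<=` G -> cell j w ->
  `|e ord0 - ctr kap (w ord0)| <= h ord0 / 2 ->
  (forall i, `|e i - ctr kap (w i)| <= K j / 4) ->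
  0 < rho -> rho <= h ord0 / 2 -> (forall i, i != ord0 -> rho <= h i) ->
  rho <= q / 16 * K j -> 0 <= t0 -> john_clearance (t0 + n%:R * K j) <= rho ->
  exists l, l <= n%:R * K j / 2 /\
    jpath G john_clearance (mktuple e) (mktuple (fun i => ctr kap (w i))) t0 l.
Proof.
have K0 := K_gt0 par j; have q0 := q_gt0 par; have ql := q_le par.
move=> eG cw e0 ei rho0 rh0 rhi rq t00 crho; set x := mktuple e; set z := mktuple _.
pose y : n.-tuple R := mktuple (fun i => if i == ord0 then ctr kap (w i) else e i).
have xy : edist x y <= n%:R * (K j / 4).
  apply: edist_le_sup => [|i]; first by rewrite divr_ge0// ltW.
  rewrite !tnth_mktuple; case: eqP => [->|_]; first exact: ei.
  by rewrite subrr normr0 divr_ge0// ltW.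
have yz : edist y z <= n%:R * (K j / 4).
  apply: edist_le_sup => [|i]; first by rewrite divr_ge0// ltW.
  rewrite !tnth_mktuple; case: eqP => [->|_]; last exact: ei.
  by rewrite subrr normr0 divr_ge0// ltW.
have nK : 0 <= n%:R * K j by rewrite mulr_ge0// ltW.
exists (edist x y + edist y z); split; first by move: xy yz; lra.
have thle (u v : n.-tuple R) th : 0 <= th -> th <= 1 -> th * edist u v <= edist u v.
  by move=> th0 th1; rewrite ler_piMl// edist_ge0.
have thge (u v : n.-tuple R) th : 0 <= th -> 0 <= th * edist u v.
  by move=> th0; rewrite mulr_ge0// edist_ge0.
have key (B : set (n.-tuple R)) (f k : 'I_n -> R) p t : box f k `<=` G ->
    (forall i, `|tnth p i - f i| + rho <= k i) ->
    0 <= t -> t <= t0 + n%:R * K j ->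
    G p /\ eball p (john_clearance t) `<=` G.
  move=> fG pk tt0 tt; split.
    by apply/fG => i; have := pk i; move: rho0; lra.
  move=> v; rewrite /eball /= => pv; apply: fG; apply: (eball_sub_box pk).
  apply: lt_le_trans pv _; apply: le_trans (clearance_mono tt0 tt) crho.
apply: (@jpath_cat _ _ _ _ y).
  apply: jpath_seg => th th0 th1; apply: (key G e h) => //.
  - move=> i; rewrite !tnth_mktuple; case: eqP => [->|/eqP i0].
      rewrite addrAC subrr add0r normrM (ger0_norm th0) distrC.
      have := ler_piMl (normr_ge0 (e ord0 - ctr kap (w ord0))) th1.
      by move: e0 rh0; lra.
    by rewrite subrr mulr0 addr0 subrr normr0 add0r rhi.
  - by rewrite addr_ge0// thge.
  - by have := thle x y th th0 th1; move: xy nK; lra.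
apply: jpath_seg => th th0 th1.
have d0 := edist_ge0 x y.
apply: (key G (pcenter kap 0 j w) (phalf kap s alpha 0 j)) => //.
- exact: piece_sub.
- move=> i; rewrite !tnth_mktuple /pcenter /= addr0; case: eqP => [->|/eqP i0].
    by rewrite subrr mulr0 addr0 subrr normr0 add0r.
  rewrite (_ : _ - _ = (1 - th) * (e i - ctr kap (w i))); last by ring.
  rewrite normrM ger0_norm ?subr_ge0//.
  have th11 : 1 - th <= 1 by lra.
  have := ler_piMl (normr_ge0 (e i - ctr kap (w i))) th11.
  have : q * K j <= 32^-1 * K j by rewrite ler_pM2r.
  by have := ei i; move: rq; lra.
- by rewrite !addr_ge0// thge.
- by have := thle y z th th0 th1; move: xy yz nK; lra.
Qed.

End JohnElbow.

Section JohnPaths.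
Context {R : realType} {m : nat}.
Local Notation n := m.+2.
Variables kap s alpha : R.
Hypothesis par : admissible kap s alpha.

Local Notation q := (unitq kap).
Local Notation K j := (kap ^+ j).
Local Notation index := {ffun 'I_n -> seq bool}.
Local Notation G := (@apartments R m kap s alpha).
Local Notation reach := (@john_reach R m kap).
Local Notation clearance := (@john_clearance R m kap s alpha).
Local Notation origin := (mktuple (fun _ : 'I_n => 0 : R)).

(** The path is assumed to start with the whole budget [reach * K j] spent, and the conclusion
    bounds this together with the remaining length, so the induction over ancestors telescopes. *)
Lemma jpath_climb j (w : index) : cell j w ->
  exists l, l + reach * K j <= reach /\
    jpath G clearance (mktuple (fun i => ctr kap (w i))) origin (reach * K j) l.
Proof.
have [kap0 kap12 s1 alpha0 alphaq] := par.
have q0 := q_gt0 par; have ql := q_le par; have r0 := reach_gt0 (m := m) par.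
have akq : alpha * kap <= q / 16.
  by apply: le_trans alphaq; rewrite ler_piMr// ?ltW//; lra.
elim: j w => [|j IH] w cw.
  exists 0; split; first by rewrite add0r expr0 mulr1.
  have -> : mktuple (fun i => ctr kap (w i)) = origin.
    apply: eq_from_tnth => i; rewrite !tnth_mktuple.
    by have := cw i; case: (w i).
  have pw i : tnth origin i - pcenter kap 0 0 w i = 0.
    rewrite tnth_mktuple /pcenter /= addr0 sub0r.
    by have := cw i; case: (w i) => //= _; rewrite oppr0.
  apply: jpath_refl.
    by apply: (piece_sub (k := 0) cw) => i; rewrite pw normr0; exact: phalf_gt0.
  move=> y; rewrite /eball /= => oy.
  apply: (piece_sub (k := 0) cw); apply: (@eball_sub_box _ _ _ _ (alpha * kap * K 0 `^ s) origin).
    by move=> i; rewrite pw normr0 add0r phalf_ge.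
  apply: lt_le_trans oy _; apply: clearance_le => //.
  by rewrite expr0 mulr1 ltW.
have K0 := K_gt0 par j; have K10 := K_gt0 par j.+1.
have KS : K j.+1 = kap * K j by rewrite exprS.
have kK : kap * K j <= K j by apply: ler_piMl; [exact: ltW|lra].
pose v : index := [ffun i => take j (w i)].
have cv : cell j v by move=> i; rewrite ffunE size_takel// cw.
have nK : 0 <= n%:R * K j by rewrite mulr_ge0// ltW.
have rK : reach * K j.+1 + n%:R * K j <= reach * K j.
  rewrite KS /john_reach (_ : _ + _ = n%:R * K j * (2 + 2 * kap)).
    rewrite (mulrAC n%:R (_ + 2)); apply: ler_wpM2l => //.
    by have := kapV_ge2 par; lra.
  by field; rewrite gt_eqF.
have rK0 : 0 <= reach * K j.+1 by rewrite mulr_ge0// ltW.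
have [l2 [l2r p2]] := IH v cv.
have [|||||||||l1 [l1r p1]] := @jpath_elbow R m kap s alpha par
    (fun i => ctr kap (w i)) (phalf kap s alpha 1 j.+1) j v (reach * K j.+1)
    (q / 16 * K j.+1) _ cv.
- move=> x bx; apply: (piece_sub (k := 1) cw) => i; have := bx i.
  by rewrite /pcenter /= addr0.
- rewrite ffunE ctr_parent//= KS invfM mulrA [kap * _]mulrC.
  rewrite -[K j * kap / 2 / kap / 2]mulrA.
  by rewrite le_eqVlt; apply/orP; left; apply/eqP; field; rewrite gt_eqF.
- by move=> i; rewrite ffunE ctr_parent.
- by rewrite mulr_gt0// divr_gt0.
- rewrite /= KS (_ : kap * K j / (2 * kap) = K j / 2); last first.
    by field; rewrite gt_eqF.
  have : q / 16 * (kap * K j) <= q / 16 * K j.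
    by apply: ler_wpM2l kK; rewrite divr_ge0// ltW.
  have : q * K j <= 32^-1 * K j by rewrite ler_pM2r.
  lra.
- by move=> i /negbTE i0 /=; rewrite i0.
- rewrite KS; have : q / 16 * (kap * K j) <= q / 16 * K j.
    by apply: ler_wpM2l kK; rewrite divr_ge0// ltW.
  exact.
- exact: rK0.
- apply: le_trans (clearance_le par (j := j) _ rK) _.
    by rewrite addr_ge0.
  rewrite KS mulrA; apply: ler_pM => //; [|exact: powR_ge0| |exact: KpowR_le par _].
    by rewrite mulr_ge0// ltW.
  by rewrite ler_pM2r.
exists (l1 + l2); split; first by move: l1r l2r rK nK; lra.
have [l10 _] := p1; apply: jpath_cat p1 _.
apply: (jpath_le (@clearance_mono R m kap s alpha par) _ _ p2).
  by rewrite addr_ge0.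
by move: l1r rK nK; lra.
Qed.

Lemma jpath_origin x : G x -> exists l, l <= reach /\ jpath G clearance x origin 0 l.
Proof.
have [kap0 kap12 s1 alpha0 alphaq] := par.
have q0 := q_gt0 par; have ql := q_le par.
move=> [k [j [w [cw px]]]].
have K0 := K_gt0 par j.
have nK : 0 < n%:R * K j by rewrite mulr_gt0.
have [l1 [l1r p1]] := jpath_to_center par cw px.
have [l3 [l3r p3]] := jpath_climb cw.
have rE : reach * K j = n%:R * (K j / (2 * kap)) * 2 + n%:R * K j * 2.
  by rewrite /john_reach; field; rewrite gt_eqF.
have [l10 _] := p1.
have [l2 [l2r p2]] : exists l, l <= n%:R * K j / 2 /\
    jpath G clearance (mktuple (pcenter kap k j w))
      (mktuple (fun i => ctr kap (w i))) l1 l.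
  have [k2|k2] := ltnP k 2.
    have -> : mktuple (pcenter kap k j w) = mktuple (fun i => ctr kap (w i)).
      by apply: eq_from_tnth => i; rewrite !tnth_mktuple /pcenter k2 addr0.
    exists 0; split; first by rewrite divr_ge0// ltW.
    set c := mktuple _.
    have pw i : tnth c i - pcenter kap 0 j w i = 0.
      by rewrite tnth_mktuple /pcenter /= addr0 subrr.
    apply: jpath_refl.
      by apply: (piece_sub (k := 0) cw) => i; rewrite pw normr0; exact: phalf_gt0.
    move=> y; rewrite /eball /= => cy; apply: (piece_sub (k := 0) cw).
    apply: (@eball_sub_box _ _ _ _ (alpha * kap * K j `^ s) c).
      by move=> i; rewrite pw normr0 add0r phalf_ge.
    apply: lt_le_trans cy _; apply: clearance_le => //.
    by move: l1r rE nK; lra.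
  have cl : clearance (l1 + n%:R * K j) <= alpha * kap * K j `^ s.
    by apply: clearance_le => //; [rewrite addr_ge0// ltW|move: l1r rE nK l10; lra].
  have eo i : `|pcenter kap 2 j w i - ctr kap (w i)| = q / 2 * K j.
    rewrite /pcenter /= addrC addKr gtr0_norm// mulr_gt0// divr_gt0//.
  have qK : q * K j <= 32^-1 * K j by rewrite ler_pM2r.
  have qK0 : 0 < q * K j by rewrite mulr_gt0.
  have akw : alpha * kap * K j `^ s <= tube_width kap s alpha j.
    by apply: ler_wpM2r; [exact: powR_ge0|rewrite ler_piMr// ltW//; lra].
  (* Room and tube share their centre, so a path from the room also leaves along the tube. Its
     clearance, of order [K j] to the power s, is what the s-John condition asks after a length of
     order [K j]. *)
  have -> : pcenter kap k j w = pcenter kap 2 j w.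
    by apply/funext => i; rewrite /pcenter ltnNge k2.
  have wq : tube_width kap s alpha j <= q / 16 * K j.
    by apply: le_trans (width_le par j) _; rewrite ler_pM2r.
  apply: (@jpath_elbow R m kap s alpha par _ (phalf kap s alpha 2 j) j w l1
    (alpha * kap * K j `^ s)) => //.
  - exact: (piece_sub cw).
  - by rewrite eo /= mulrAC.
  - by move=> i; rewrite eo; move: qK qK0; lra.
  - by rewrite !mulr_gt0// powR_gt0.
  - by move: akw wq qK0 => /=; lra.
  - by move=> i /negbTE i0 /=; rewrite i0.
  - exact: le_trans akw wq.
exists (l1 + (l2 + l3)); split.
  by move: l1r l2r l3r rE nK; lra.
have [l20 _] := p2.
apply: jpath_cat p1 _; rewrite add0r; apply: jpath_cat p2 _.
apply: (jpath_le (@clearance_mono R m kap s alpha par) _ _ p3).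
  by rewrite addr_ge0.
by move: l1r l2r rE nK; lra.
Qed.

End JohnPaths.

(** * Isolation of tubes and rooms, points of the complement *)

Section Isolation.
Context {R : realType} {m : nat}.
Local Notation n := m.+2.
Variables kap s alpha : R.
Hypothesis par : admissible kap s alpha.

Local Notation q := (unitq kap).
Local Notation K j := (kap ^+ j).
Local Notation index := {ffun 'I_n -> seq bool}.
Local Notation G := (@apartments R m kap s alpha).
Local Notation origin := (mktuple (fun _ : 'I_n => 0 : R)).
Local Notation i1 := (lift ord0 ord0 : 'I_n).

Lemma core_uniq_unitq (y : R) (u v : seq bool) :
  `|y - ctr kap u| < 4 * q * K (size u) ->
  `|y - ctr kap v| < 4 * q * K (size v) -> u = v.
Proof.
have [kap0 kap12 _ _ _] := par.
have -> : 4 * q = gap kap / 2 by rewrite /unitq; field.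
exact: core_uniq.
Qed.

Lemma pcenter_core k j (w : index) (y : n.-tuple R) : (2 <= k)%N ->
  piece kap s alpha k j w y ->
  forall i, `|tnth y i - ctr kap (w i)| <= 3 / 2 * q * K j.
Proof.
have q0 := q_gt0 par; have K0 := K_gt0 par j.
have qK0 : 0 < q * K j by rewrite mulr_gt0.
have wq : tube_width kap s alpha j <= q / 16 * K j.
  have [_ _ _ _ aq] := par.
  by apply: le_trans (width_le par j) _; rewrite ler_pM2r.
move=> k2 py i; have := py i; rewrite /pcenter ltnNge k2 /=.
have hq : phalf kap s alpha k j i <= q * K j.
  by case: k k2 {py} => [|[|[|k]]]//= _; try case: ifP => _ //; move: wq qK0; lra.
move=> /lt_le_trans /(_ hq); rewrite ltr_norml ler_norml => /andP[h1 h2].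
by apply/andP; split; move: qK0; lra.
Qed.

Lemma apartment_uniq k' j j' (w w' : index) (y : n.-tuple R) :
  cell j w -> cell j' w' ->
  (forall i, `|tnth y i - ctr kap (w i)| < 4 * q * K j) ->
  (2 <= k')%N -> piece kap s alpha k' j' w' y -> w' = w /\ j' = j.
Proof.
have q0 := q_gt0 par.
move=> cw cw' yw k2 py.
have e : w' = w.
  apply/ffunP => i; apply/esym; apply: (@core_uniq_unitq (tnth y i)).
    by rewrite cw; exact: yw.
  rewrite cw'; apply: le_lt_trans (pcenter_core k2 py i) _.
  by have := mulr_gt0 q0 (K_gt0 par j'); lra.
by split=> //; rewrite -(cw ord0) -(cw' ord0) e.
Qed.

(* Cores of distinct cells have disjoint projections on every axis, so the plates
   are excluded by the zeroth coordinate alone and the arms by the next one. *)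
Lemma isolation j (w : index) (y : n.-tuple R) : cell j w ->
  (forall i, `|tnth y i - ctr kap (w i)| < 4 * q * K j) ->
  q / 16 * K j <= tnth y ord0 - ctr kap (w ord0) ->
  q / 16 * K j <= tnth y i1 - ctr kap (w i1) ->
  G y -> exists k, (2 <= k)%N /\ piece kap s alpha k j w y.
Proof.
have q0 := q_gt0 par.
move=> cw yw y0 y1 [k [j' [v [cv py]]]].
have qK i : 0 < q * K i by rewrite mulr_gt0// (K_gt0 par).
have avoid i : `|tnth y i - ctr kap (v i)| < q / 16 * K j' ->
    q / 16 * K j <= tnth y i - ctr kap (w i) -> False.
  move=> yv yi; have e : w i = v i.
    apply: (@core_uniq_unitq (tnth y i)); first by rewrite cw.
    by rewrite cv; have := qK j'; move: yv; lra.
  have jj : j' = j by rewrite -(cw i) -(cv i) e.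
  by move: yv yi; rewrite -e jj ltr_norml => /andP[_]; lra.
have [k2|] := leqP 2 k.
  exists k; split=> //.
  by have [<- <-] := apartment_uniq cw cv yw k2 py.
case: k py => [|[|//]] py _.
  by have := py ord0; rewrite /pcenter /= addr0 => /avoid /(_ y0).
by have := py i1; rewrite /pcenter /= addr0 => /avoid /(_ y1).
Qed.

(** Between the end of the plate at [q / 16] and the start of the room at [q / 4], [isolation]
    leaves only the tube of the cell. Pushing the coordinate [i1] to a lateral face of this open
    tube therefore leaves [G]. *)
Lemma wall j (w : index) (z : n.-tuple R) : cell j w ->
  q / 16 * K j <= tnth z ord0 - ctr kap (w ord0) ->
  tnth z ord0 - ctr kap (w ord0) <= q / 4 * K j ->
  (forall i, i != ord0 ->
     `|tnth z i - pcenter kap 2 j w i| <= tube_width kap s alpha j) ->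
  exists z', ~ G z' /\ edist z z' <= n%:R * (2 * tube_width kap s alpha j).
Proof.
have q0 := q_gt0 par; have K0 := K_gt0 par j.
have qK0 : 0 < q * K j by rewrite mulr_gt0.
have wq : tube_width kap s alpha j <= q / 16 * K j.
  have [_ _ _ _ aq] := par.
  by apply: le_trans (width_le par j) _; rewrite ler_pM2r.
have w0 := width_gt0 par j.
move=> cw zl zu zi.
pose z' : n.-tuple R := mktuple (fun i => if i == i1
  then pcenter kap 2 j w i + tube_width kap s alpha j else tnth z i).
have z'0 : tnth z' ord0 = tnth z ord0 by rewrite tnth_mktuple.
have z'1 : tnth z' i1 = pcenter kap 2 j w i1 + tube_width kap s alpha j.
  by rewrite tnth_mktuple eqxx.
exists z'; split.
- move=> Gz'; have [] := @isolation j w z' cw _ _ _ Gz'.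
  + move=> i; have [->|i0] := eqVneq i ord0.
      rewrite z'0 ger0_norm; last by move: zl qK0; lra.
      by move: zu qK0; lra.
    have : `|tnth z' i - pcenter kap 2 j w i| <= tube_width kap s alpha j.
      rewrite tnth_mktuple; case: eqP => [->|_]; last exact: zi.
      by rewrite addrAC subrr add0r gtr0_norm.
    rewrite /pcenter /= ler_norml ltr_norml => /andP[h1 h2].
    by apply/andP; split; move: wq qK0 w0; lra.
  + by rewrite z'0.
  + by rewrite z'1 /pcenter /=; move: wq qK0 w0; lra.
  + move=> [|[|[|k]]] [//= _ pz].
      have := pz i1; rewrite z'1 addrAC subrr add0r gtr0_norm//=.
      by rewrite ltxx.
    have := pz ord0; rewrite z'0 /pcenter /= ltr_norml => /andP[h _].
    by move: h zu; lra.
- apply: edist_le_sup => [|i]; first by rewrite mulr_ge0// ltW.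
  rewrite tnth_mktuple; case: eqP => [->|_]; last first.
    by rewrite subrr normr0 mulr_ge0// ltW.
  have := zi i1 isT; rewrite !ler_norml => /andP[h1 h2].
  by apply/andP; split; move: w0; lra.
Qed.

(** The point [z] is on the tube axis at level [q / 8], inside the stretch treated by [wall]. This
    puts boundary points near every cell centre, for the lower bound of the dimension. *)
Lemma near_wall j (w : index) : cell j w ->
  exists z', ~ G z' /\
    edist (mktuple (fun i => ctr kap (w i))) z' <= n%:R * K j.
Proof.
have q0 := q_gt0 par; have ql := q_le par; have K0 := K_gt0 par j.
have qK0 : 0 < q * K j by rewrite mulr_gt0.
have wq : tube_width kap s alpha j <= q / 16 * K j.
  have [_ _ _ _ aq] := par.
  by apply: le_trans (width_le par j) _; rewrite ler_pM2r.
have w0 := width_gt0 par j.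
have qK : q * K j <= 32^-1 * K j by rewrite ler_pM2r.
move=> cw; pose z : n.-tuple R := mktuple (fun i => if i == ord0
  then ctr kap (w i) + q / 8 * K j else pcenter kap 2 j w i).
have [z' [Gz' zz']] : exists z', ~ G z' /\
    edist z z' <= n%:R * (2 * tube_width kap s alpha j).
  apply: (@wall j w) => //.
  - by rewrite tnth_mktuple /= addrC addKr; move: qK0; lra.
  - by rewrite tnth_mktuple /= addrC addKr; move: qK0; lra.
  - by move=> i /negbTE i0; rewrite tnth_mktuple i0 subrr normr0 ltW.
exists z'; split=> //; set c := mktuple _.
have cz : edist c z <= n%:R * (q / 2 * K j).
  apply: edist_le_sup => [|i]; first by move: qK0; lra.
  rewrite !tnth_mktuple distrC; case: ifP => _; rewrite /pcenter /= addrC addKr.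
    by rewrite gtr0_norm; move: qK0; lra.
  by rewrite gtr0_norm; move: qK0; lra.
have := edist_triangle z c z'.
have : n%:R * (2 * tube_width kap s alpha j) + n%:R * (q / 2 * K j) <= n%:R * K j.
  by rewrite -mulrDr ler_pM2l//; move: wq qK K0; lra.
by move: cz zz'; lra.
Qed.

Lemma cell_origin : cell 0 ([ffun => [::]] : index).
Proof. by move=> i; rewrite ffunE. Qed.

Lemma center_in j (w : index) : cell j w -> G (mktuple (fun i => ctr kap (w i))).
Proof.
move=> cw; apply: (piece_sub (k := 0) cw) => i.
rewrite (_ : _ - _ = 0); last by rewrite tnth_mktuple /pcenter /= addr0 subrr.
by rewrite normr0; exact: phalf_gt0.
Qed.

Lemma boundary_near j (w : index) : cell j w ->
  exists2 z, boundary G z & edist (mktuple (fun i => ctr kap (w i))) z <= n%:R * K j.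
Proof.
move=> cw; have [z' [Gz' cz']] := near_wall cw.
have [t [t0 t1 bt]] := seg_exit (apartments_open (s := s) (alpha := alpha)) (center_in cw) Gz'.
exists (seg (mktuple (fun i => ctr kap (w i))) z' t) => //.
rewrite -{1}(seg0 (mktuple (fun i => ctr kap (w i))) z') edist_seg sub0r normrN ger0_norm//.
by apply: le_trans cz'; rewrite ler_piMl// edist_ge0.
Qed.

Lemma boundary_nonempty : boundary G !=set0.
Proof. by have [z bz _] := boundary_near cell_origin; exists z. Qed.

Lemma apartments_bound x i : G x -> `|tnth x i| <= 1 + (2 * kap)^-1.
Proof.
have q0 := q_gt0 par; have ql := q_le par; have [kap0 kap12 _ _ _] := par.
move=> [k [j [w [cw px]]]]; have K1 := K_le1 par j; have K0 := K_gt0 par j.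
have := px i; have hp := phalf_le par k j i.
have hk : K j / (2 * kap) <= (2 * kap)^-1.
  by rewrite ler_piMl// invr_ge0 mulr_ge0// ltW.
have := ctr_le kap0 kap12 (w i).
have : `|pcenter kap k j w i - ctr kap (w i)| <= 2^-1.
  rewrite /pcenter addrC addKr; case: ifP => _; first by rewrite normr0; lra.
  rewrite gtr0_norm; last by apply: mulr_gt0 => //; exact: divr_gt0.
  have : q * K j <= 32^-1 * K j by rewrite ler_pM2r.
  by move: K1 K0; lra.
rewrite !ler_norml ltr_norml => /andP[a1 a2] /andP[b1 b2] /andP[c1 c2].
by apply/andP; split; move: hp hk; lra.
Qed.

Lemma apartments_John : John_domain s G.
Proof.
have oG := @apartments_open R m kap s alpha.
have G0 : G origin.
  have := center_in cell_origin; congr (G _).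
  by apply: eq_from_tnth => i; rewrite !tnth_mktuple ffunE.
have [kap0 kap12 _ _ _] := par.
have r0 := reach_gt0 (m := m) par.
split.
  split; first by exists origin.
  split=> //; split.
    (* On a path from a point of [V] to the origin in [U], the exit point from [V] lies in [G],
       hence in the open set [U]; nearby points of [V] then lie in all three sets. *)
    have half (U V : set (n.-tuple R)) : eopen U -> eopen V -> G `<=` U `|` V ->
        U `&` V `&` G = set0 -> U origin -> V `&` G !=set0 -> False.
      move=> oU oV GUV UVG U0 [y [Vy Gy]].
      have [l [_ [l0 [gam [us gam0 gaml Ggam]]]]] := jpath_origin par Gy.
      have Uy : ~ U y.
        by move=> Uy; have : (U `&` V `&` G) y by []; rewrite UVG.
      have lip a b : 0 <= a -> a <= b -> b <= l ->
          edist (gam a) (gam b) <= b - a by move=> *; apply: (us _ _ _ _ _).1.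
      have [||t [t0 tl bt]] := @curve_exit _ _ V gam l l0 oV lip.
      - by rewrite gam0.
      - by rewrite gaml => Vo; have : (U `&` V `&` G) origin by []; rewrite UVG.
      have [Gt _] := Ggam t t0 tl.
      have nVt := boundary_notin oV bt.
      have Ut : U (gam t) by case: (GUV _ Gt).
      have [e1 e10 eU] := oU _ Ut; have [e2 e20 eG] := oG _ Gt.
      have [|[z [Vz tz]] _] := bt (Num.min e1 e2); first by rewrite lt_min e10.
      suff : (U `&` V `&` G) z by rewrite UVG.
      move: tz; rewrite lt_min => /andP[tz1 tz2].
      by split; [split=> //; exact: eU|exact: eG].
    move=> [U [V [oU [oV [GUV [UVG [UG VG]]]]]]].
    have [U0|V0] := GUV _ G0; first exact: half U V oU oV GUV UVG U0 VG.
    by apply: (half V U oV oU) => //; [rewrite setUC|rewrite (setIC V)].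
  exists (n%:R * (2 * (1 + (2 * kap)^-1))) => x y Gx Gy; apply: edist_le_sup => [|i].
    by rewrite mulr_ge0// addr_ge0// invr_ge0 mulr_ge0// ltW.
  have := apartments_bound i Gx; have := apartments_bound i Gy.
  by have := ler_normB (tnth x i) (tnth y i); lra.
exists origin; split=> //; exists (john_const (m := m) kap s alpha).
  exact: jconst_gt0.
move=> x Gx; have [l [lr [l0 [gam [us gam0 gaml Ggam]]]]] := jpath_origin par Gx.
exists gam, l; split=> //.
- exact: unit_speed_arclength.
- apply: le_trans lr _; rewrite /john_const lerDr divr_ge0 ?powR_ge0//.
  by have [_ _ _ a0 _] := par; rewrite mulr_ge0// ltW.
- move=> t t0 tl; have [Gt bt] := Ggam t t0 tl; split=> //.
  by apply: dist_boundary_ge => //; [exact: boundary_nonempty|rewrite add0r in bt].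
Qed.

End Isolation.

(** [A] is arbitrary, as neighbourhoods of the boundary will be: subadditivity is applied to the
    measurable cover and reaches [A] by monotonicity. *)
Lemma lebn_cover_le (R : realType) n (I : choiceType) (r : seq I)
    (F : I -> set (n.-tuple R)) (A : set (n.-tuple R)) :
  (forall i, measurable (F i)) ->
  (forall z, A z -> exists2 i, i \in r & F i z) ->
  (lebn A <= \sum_(i <- r) lebn (F i))%E.
Proof.
move=> mF AF; apply: le_trans (lebn_bigcup_le r mF); apply: lebn_le => z /AF[i ir Fi].
by rewrite -bigcup_seq; exists i.
Qed.

Lemma lebn_cover_const (R : realType) n (I : choiceType) (r : seq I)
    (F : I -> set (n.-tuple R)) (A : set (n.-tuple R)) (M : R) :
  (forall i, measurable (F i)) ->
  (forall z, A z -> exists2 i, i \in r & F i z) ->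
  (forall i, i \in r -> lebn (F i) <= M%:E)%E ->
  (lebn A <= ((size r)%:R * M)%:E)%E.
Proof.
move=> mF AF FM; apply: le_trans (lebn_cover_le mF AF) _.
rewrite big_seq; apply: le_trans (lee_sum _ FM) _.
by rewrite -big_seq sumEFin big_const_seq count_predT iter_addr_0 mulr_natl.
Qed.

Lemma sum_lebn_le (R : realType) n (I : eqType) (r : seq I)
    (F : I -> set (n.-tuple R)) (A : set (n.-tuple R)) : uniq r ->
  (forall i, measurable (F i)) -> (forall i, i \in r -> F i `<=` A) ->
  (forall i j z, i \in r -> j \in r -> F i z -> F j z -> i = j) ->
  (\sum_(i <- r) lebn (F i) <= lebn A)%E.
Proof.
move=> ur mF FA Fdis.
suff [U [mU UA UE]] : exists U, [/\ measurable U,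
    (forall z, U z -> exists2 i, i \in r & F i z) &
    \sum_(i <- r) lebn (F i) = lebn U]%E.
  rewrite UE; apply: lebn_le => z /UA[i ir]; exact: FA.
have [mu muE] := lebn_measure R n; rewrite muE.
elim: r ur {FA} Fdis => [|i r IH] /= => [_ _|/andP[ir ur] Fdis].
  by exists set0; rewrite big_nil measure0; split.
have [|U [mU UF UE]] := IH ur.
  by move=> a b z ar br; apply: Fdis; rewrite inE ?ar ?br orbT.
exists (F i `|` U); split.
- exact: measurableU.
- move=> z [Fz|/UF[j jr Fj]]; first by exists i => //; rewrite inE eqxx.
  by exists j => //; rewrite inE jr orbT.
- rewrite big_cons UE measureU//; apply/seteqP; split=> // z [Fz /UF[j jr Fj]].
  have e : i = j by apply: (Fdis i j z) => //; rewrite inE ?eqxx ?jr ?orbT.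
  by move: ir; rewrite e jr.
Qed.

(** * Minkowski dimension of the boundary *)

Section Cells.
Context {n : nat}.
Local Notation index := {ffun 'I_n -> seq bool}.

Definition cells (j : nat) : seq index :=
  [seq [ffun i => tval ((w : {ffun 'I_n -> j.-tuple bool}) i)]
     | w <- enum {: {ffun 'I_n -> j.-tuple bool}}].

Lemma mem_cells j (w : index) : w \in cells j <-> (forall i, size (w i) = j).
Proof.
split=> [/mapP[v _ ->] i|cw]; first by rewrite ffunE size_tuple.
apply/mapP; exists [ffun i => Tuple (introT eqP (cw i))].
  by rewrite mem_enum.
by apply/ffunP => i; rewrite !ffunE.
Qed.

Lemma size_cells j : size (cells j) = ((2 ^ j) ^ n)%N.
Proof.
by rewrite size_map -cardE card_ffun card_tuple card_bool card_ord.
Qed.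

Lemma uniq_cells j : uniq (cells j).
Proof.
rewrite map_inj_uniq ?enum_uniq// => u v /ffunP uv; apply/ffunP => i.
by have := uv i; rewrite !ffunE => /val_inj.
Qed.

End Cells.

Lemma expr_small (R : realType) (x e : R) : 0 <= x -> x < 1 -> 0 < e ->
  exists N, forall j, (N <= j)%N -> x ^+ j < e.
Proof.
move=> x0 x1 e0.
have /cvgrPdist_lt /(_ e e0) [N _ HN] : (fun j => x ^+ j) @ \oo --> (0 : R).
  by apply: cvg_expr; rewrite ger0_norm.
by exists N => j /HN /=; rewrite sub0r normrN ger0_norm ?exprn_ge0.
Qed.

(** Each of the first J terms of the geometric series is at least x^J. This absorbs the factor J
    that appears when all generations of faces weigh the same, as for lam = n-1. *)
Lemma mul_expr_le (R : realType) (x : R) (J : nat) : 0 <= x -> x < 1 ->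
  J%:R * x ^+ J <= (1 - x)^-1.
Proof.
move=> x0 x1; apply: (@le_trans _ _ (\sum_(i < J) x ^+ i)).
  rewrite mulr_natl -[in leLHS](card_ord J) -sumr_const; apply: ler_sum => i _.
  by apply: ler_wiXn2l => //; [exact: ltW|rewrite card_ord ltnW].
have x10 : 0 < 1 - x by rewrite subr_gt0.
rewrite -(ler_pM2l x10) divff ?gt_eqF// -opprB mulNr -subrX1.
by rewrite opprB gerBl exprn_ge0.
Qed.

Lemma scale_between (R : realType) (z r : R) : 0 < z -> z < 1 -> 0 < r -> r <= 1 ->
  exists J, z ^+ J.+1 <= r /\ r <= z ^+ J.
Proof.
move=> z0 z1 r0 r1.
have ex : exists N, z ^+ N.+1 <= r.
  have [N HN] := expr_small (ltW z0) z1 r0.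
  by exists N; apply/ltW/HN.
exists (ex_minn ex); case: ex_minnP => J HJ Hmin; split=> //.
case: J HJ Hmin => [|J] _ Hmin; first by rewrite expr0.
by rewrite leNgt; apply/negP => /ltW /Hmin; rewrite ltnn.
Qed.

Lemma powRX (R : realType) (a e : R) k : 0 <= a -> (a ^+ k) `^ e = (a `^ e) ^+ k.
Proof. by move=> a0; rewrite -powR_mulrn// powRAC powR_mulrn ?powR_ge0. Qed.

Lemma ler_powR_neg (R : realType) (a b e : R) : 0 < a -> a <= b -> e <= 0 ->
  b `^ e <= a `^ e.
Proof.
move=> a0 ab e0; have b0 := lt_le_trans a0 ab.
have [f f0 ->] : exists2 f, 0 <= f & e = - f.
  by exists (- e); rewrite ?opprK ?oppr_ge0.
rewrite !powRN lef_pV2 ?posrE ?powR_gt0//.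
by apply: ge0_ler_powR => //; rewrite nnegrE ltW.
Qed.

Lemma powR_lt1 (R : realType) (a e : R) : 0 < a -> a < 1 -> 0 < e -> a `^ e < 1.
Proof.
move=> a0 a1 e0; rewrite -(powRr0 a) /powR !gt_eqF// ltr_expR mul0r.
by rewrite pmulr_rlt0// ln_lt0// a0.
Qed.

Section Minkowski.
Context {R : realType} {m : nat}.
Local Notation n := m.+2.
Variables kap s alpha lam : R.
Hypothesis par : admissible kap s alpha.
Hypothesis kap_lam : (2 : R) ^+ n * kap `^ lam = 1.

Local Notation K j := (kap ^+ j).
Local Notation index := {ffun 'I_n -> seq bool}.
Local Notation G := (@apartments R m kap s alpha).

Lemma K_powR j x : K j `^ x = (kap `^ x) ^+ j.
Proof.
have [kap0 _ _ _ _] := par.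
by rewrite powRX ?ltW.
Qed.

(** The relation 2^n kap^lam = 1 raised to the power j: generation j has exactly [K j] to the power
    [- lam] cells. *)
Lemma count_cells j x :
  (size (cells (n := n) j))%:R * K j `^ x = K j `^ (x - lam).
Proof.
have K0 := K_gt0 par j.
have E : (size (cells (n := n) j))%:R * K j `^ lam = 1.
  by rewrite size_cells K_powR -expnM mulnC expnM natrX natrX -exprMn kap_lam expr1n.
have L0 : K j `^ lam != 0 by rewrite gt_eqF// powR_gt0.
rewrite powRB; last by rewrite (gt_eqF K0) implybT.
by apply: (mulIf L0); rewrite mulfVK// mulrAC E mul1r.
Qed.

(** The cores of generation j are disjoint boxes of volume (gap K j)^n within 2 n K j of the
    boundary. With r = 2 n K j, their total volume times r^(x-n) is a constant times (K j)^(x-lam),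
    which is unbounded. *)
Lemma minkowski_lower x : x < lam -> minkowski_blowup (boundary G) x.
Proof.
have [kap0 kap12 _ _ _] := par; have g0 := gap_gt0 kap0 kap12.
have gl := gap_le kap0 kap12.
move=> xlam M eps eps0.
pose C0 : R := n%:R * 2.
have C00 : 0 < C0 by rewrite mulr_gt0.
have y0 : 0 < kap `^ (lam - x) by exact: powR_gt0.
have y1 : kap `^ (lam - x) < 1.
  by apply: powR_lt1; lra.
pose V := gap kap ^+ n * C0 `^ (x - n%:R).
have V0 : 0 < V by rewrite mulr_gt0 ?exprn_gt0// powR_gt0.
have M0 : 0 < `|M| + 1 by rewrite ltr_wpDl.
have [N1 HN1] := expr_small (ltW y0) y1 (divr_gt0 V0 M0).
have [N2 HN2] : exists N, forall j, (N <= j)%N -> kap ^+ j < eps / C0.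
  by apply: expr_small; [exact: ltW|lra|exact: divr_gt0].
pose j := maxn N1 N2.
have K0 := K_gt0 par j.
have h1 := HN1 j (leq_maxl _ _); have h2 := HN2 j (leq_maxr _ _).
exists (C0 * K j); split; first by rewrite mulr_gt0.
  by rewrite mulrC -ltr_pdivlMr.
pose B (w : index) := box (fun i => ctr kap (w i)) (fun _ : 'I_n => gap kap / 2 * K j).
have gK0 : 0 <= gap kap / 2 * K j by have := mulr_gt0 g0 K0; lra.
have vol : (((size (cells (n := n) j))%:R * (gap kap * K j) ^+ n)%:E <=
    lebn (nbhd_set (boundary G) (C0 * K j)))%E.
  apply: le_trans (sum_lebn_le (F := B) (uniq_cells j) _ _ _); last 3 first.
  - by move=> w; exact: measurable_box.
  - move=> w /mem_cells cw z Bz.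
    have [y by_ cy] := boundary_near par cw; exists y => //.
    have := edist_triangle (mktuple (fun i => ctr kap (w i))) z y.
    have : edist z (mktuple (fun i => ctr kap (w i))) <= n%:R * (gap kap / 2 * K j).
      by apply: edist_le_sup => // i; rewrite tnth_mktuple ltW// (Bz i).
    have gKK : gap kap / 2 * K j < K j by rewrite gtr_pMl//; lra.
    have : n%:R * (gap kap / 2 * K j) < n%:R * K j by rewrite ltr_pM2l.
    by rewrite /C0; move: cy; lra.
  - move=> u v z /mem_cells cu /mem_cells cv uz vz; apply/ffunP => i.
    apply: (@core_uniq _ _ kap0 kap12 (tnth z i)); first by rewrite cu; exact: uz.
    by rewrite cv; exact: vz.
  rewrite /B (eq_bigr (fun=> ((gap kap * K j) ^+ n)%:E)); last first.
    move=> w _; rewrite lebn_box// prodr_const card_ord; congr (_ ^+ _)%:E.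
    by field.
  by rewrite sumEFin lee_fin big_const_seq count_predT iter_addr_0 mulr_natl.
have p0 : 0 <= (C0 * K j) `^ (x - n%:R) by exact: powR_ge0.
have := lee_wpmul2r (_ : 0 <= ((C0 * K j) `^ (x - n%:R))%:E)%E vol.
rewrite lee_fin => /(_ p0); apply: lt_le_trans.
rewrite -EFinM lte_fin.
have -> : (size (cells (n := n) j))%:R * (gap kap * K j) ^+ n *
    (C0 * K j) `^ (x - n%:R) = V * K j `^ (x - lam).
  have E : K j `^ x = K j ^+ n * K j `^ (x - n%:R).
    rewrite -[K j ^+ n]powR_mulrn ?(ltW K0)// -powRD; last by rewrite (gt_eqF K0) implybT.
    by congr (_ `^ _); ring.
  rewrite -count_cells powRM ?(ltW C00) ?(ltW K0)// exprMn /V E; ring.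
have -> : K j `^ (x - lam) = ((kap `^ (lam - x)) ^+ j)^-1.
  by rewrite -K_powR -powRN opprB.
have yj0 : 0 < (kap `^ (lam - x)) ^+ j by rewrite exprn_gt0.
rewrite ltr_pdivlMr//; move: h1; rewrite ltr_pdivlMr//; apply: le_lt_trans.
by rewrite mulrC ler_pM2l//; have := ler_norm M; lra.
Qed.

End Minkowski.

Section MinkowskiUpper.
Context {R : realType} {m : nat}.
Local Notation n := m.+2.
Variables kap s alpha : R.
Hypothesis par : admissible kap s alpha.

Local Notation q := (unitq kap).
Local Notation K j := (kap ^+ j).
Local Notation index := {ffun 'I_n -> seq bool}.
Local Notation G := (@apartments R m kap s alpha).

(* The face orthogonal to the axis [i], on the side given by [b]. *)
Definition face (r : R) (k j : nat) (w : index) (i : 'I_n) (b : bool) :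
    set (n.-tuple R) :=
  box (fun i' => pcenter kap k j w i' +
         (if i' == i then (-1) ^+ b * phalf kap s alpha k j i' else 0))
      (fun i' => (if i' == i then 0 else phalf kap s alpha k j i') + 2 * r).

(** In [phalf] every kind from 3 on is a room; reducing to four kinds makes the faces of a
    generation countable by a finite number. *)
Lemma piece_kind4 k j (w : index) :
  exists k' : 'I_4, piece kap s alpha k j w = piece kap s alpha k' j w.
Proof.
have [k4|k4] := ltnP k 4; first by exists (Ordinal k4).
exists (Ordinal (isT : (3 < 4)%N)).
rewrite /piece; congr box; apply/funext => i.
  by rewrite /pcenter /= ltnNge (leq_trans _ k4).
by case: k k4 => [|[|[|[|k]]]].
Qed.

Lemma lebn_face (r : R) k j (w : index) i b : 0 <= r -> r <= K j ->
  (lebn (face r k j w i b) <= (4 * r * ((kap^-1 + 4) * K j) ^+ m.+1)%:E)%E.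
Proof.
have [kap0 _ _ _ _] := par; have K0 := K_gt0 par j.
move=> r0 rK; rewrite lebn_box; last first.
  move=> i'; rewrite addr_ge0 ?mulr_ge0//.
  by case: ifP => // _; apply/ltW/phalf_gt0.
rewrite lee_fin (bigD1 i)//= eqxx add0r mulrA -natrM.
apply: ler_pM => //; first by rewrite mulr_ge0.
  apply: prodr_ge0 => i' /negbTE ->.
  by rewrite mulr_ge0// addr_ge0 ?mulr_ge0//; apply/ltW/phalf_gt0.
apply: (@le_trans _ _ (\prod_(i' < n | i' != i) ((kap^-1 + 4) * K j))).
  apply: ler_prod => i' /negbTE ->; apply/andP; split.
    by rewrite mulr_ge0// addr_ge0 ?mulr_ge0//; apply/ltW/phalf_gt0.
  have := phalf_le par k j i'.
  rewrite (_ : K j / (2 * kap) = kap^-1 * K j / 2); first by move: rK; lra.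
  by field; rewrite gt_eqF.
by rewrite prodr_const cardC1 card_ord.
Qed.

(** A boundary point has a point of some piece within r but is outside that piece, so a face
    separates them. Pieces of generation at least J are swallowed by an enlarged ancestor cell, and
    this also treats the limit points in the dust, since only a nearby point of [G] is used. *)
Lemma boundary_cover (r : R) J z : 0 < r -> r <= K J -> nbhd_set (boundary G) r z ->
  (exists2 w : index, w \in cells J &
     box (fun i => ctr kap (w i)) (fun=> (3 + kap^-1) * K J) z) \/
  (exists j (w : index) (k : 'I_4) i b,
     [/\ (j < J)%N, w \in cells j & face r k j w i b z]).
Proof.
have [kap0 kap12 _ _ _] := par; have q0 := q_gt0 par; have ql := q_le par.
move=> r0 rJ [y by_ zy].
have [[g [Gg yg]] _] := by_ _ r0.
have Gy := boundary_notin (apartments_open (alpha := alpha)) by_.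
have [k0 [j [w [cw pg]]]] := Gg.
have [k kE] := piece_kind4 k0 j w; rewrite kE in pg.
have zg i : `|tnth z i - tnth g i| < 2 * r.
  have := ler_distD (tnth y i) (tnth z i) (tnth g i).
  by have := ler_coord_edist z y i; have := ler_coord_edist y g i; move: zy yg; lra.
have [jJ|Jj] := ltnP j J.
  right; exists j, w, k.
  have [i yi] : exists i, phalf kap s alpha k j i <=
      `|tnth y i - pcenter kap k j w i|.
    apply: contrapT => H; apply: Gy; apply: (piece_sub (k := k) cw) => i.
    by rewrite ltNge; apply/negP => yi; apply: H; exists i.
  have gi := pg i.
  have zy' := ler_coord_edist z y i; have yg' := ler_coord_edist y g i.
  exists i, (tnth y i - pcenter kap k j w i < 0); split=> //; first exact/mem_cells.
  move=> i'; case: (eqVneq i' i) => [->|_]; last first.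
    rewrite addr0; have := pg i'; have := zg i'.
    by have := ler_distD (tnth g i') (tnth z i') (pcenter kap k j w i'); lra.
  move: yi gi zy' yg' zy yg; rewrite !ler_norml ler_normr !ltr_norml add0r.
  case: (ltP (tnth y i - pcenter kap k j w i) 0) => y0 /= /orP h /andP[g1 g2] /andP[a1 a2] /andP[b1 b2] c d.
    by apply/andP; rewrite expr1; case: h => h; split; lra.
  by apply/andP; rewrite expr0; case: h => h; split; lra.
left; pose v : index := [ffun i => take J (w i)].
have cv : cell J v by move=> i; rewrite ffunE size_takel// cw.
exists v; first exact/mem_cells.
have K0 := K_gt0 par J; have Kj0 := K_gt0 par j.
have KjJ : K j <= K J by exact: kapX_le.
move=> i; rewrite ffunE.
have /= := @ctr_take _ _ kap0 kap12 J (w i); rewrite cw => /(_ Jj) h1.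
have h2 : `|pcenter kap k j w i - ctr kap (w i)| <= 32^-1 * K J.
  rewrite /pcenter addrC addKr; case: ifP => _.
    by rewrite normr0 mulr_ge0// ltW.
  rewrite gtr0_norm; last by apply: mulr_gt0 => //; exact: divr_gt0.
  have : q * K j <= 32^-1 * K j by rewrite ler_pM2r.
  by have := mulr_gt0 q0 Kj0; lra.
have h3 := pg i; have h4 := zg i; have h5 := phalf_le par k j i.
have h6 : K j / (2 * kap) <= kap^-1 * K J.
  rewrite (_ : K j / (2 * kap) = kap^-1 / 2 * K j); last by field; rewrite gt_eqF.
  have ki : 0 < kap^-1 by rewrite invr_gt0.
  by apply: ler_pM => //; [rewrite divr_ge0// ltW|exact: ltW|lra].
have t1 := ler_distD (tnth g i) (tnth z i) (ctr kap (take J (w i))).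
have t2 := ler_distD (pcenter kap k j w i) (tnth g i) (ctr kap (take J (w i))).
have t3 := ler_distD (ctr kap (w i)) (pcenter kap k j w i) (ctr kap (take J (w i))).
by move: rJ; lra.
Qed.

Lemma lebn_nbhd_boundary (r : R) J : 0 < r -> r <= K J ->
  (lebn (nbhd_set (boundary G) r) <=
   ((size (cells (n := n) J))%:R * (2 * ((3 + kap^-1) * K J)) ^+ n +
    \sum_(j < J) (size (cells (n := n) j) * (4 * n * 2))%:R *
      (4 * r * ((kap^-1 + 4) * K j) ^+ m.+1))%:E)%E.
Proof.
have [kap0 kap12 _ _ _] := par; have KJ0 := K_gt0 par J.
move=> r0 rJ.
pose T := {: 'I_4 * 'I_n * bool}.
pose L j : seq (index * T) := [seq (w, t) | w <- cells j, t <- enum T].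
pose F j (p : index * T) := face r p.2.1.1 j p.1 p.2.1.2 p.2.2.
pose A0 : set (n.-tuple R) := \big[setU/set0]_(w <- cells J)
  box (fun i => ctr kap ((w : index) i)) (fun=> (3 + kap^-1) * K J).
(* A single family over 0..J: indices below J carry the faces of that generation, the index J the
   ancestor boxes of all finer pieces. *)
pose A j : set (n.-tuple R) := if (j < J)%N then \big[setU/set0]_(p <- L j) F j p else A0.
have mA j : measurable (A j).
  rewrite /A; case: ifP => _; apply: bigsetU_measurable => *; exact: measurable_box.
have cov z : nbhd_set (boundary G) r z -> exists2 j, j \in iota 0 J.+1 & A j z.
  case/(boundary_cover r0 rJ) => [[w wJ bz]|[j [w [k [i [b [jJ wj fz]]]]]]].
    exists J; first by rewrite mem_iota /= add0n ltnS leqnn.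
    by rewrite /A ltnn /A0 -bigcup_seq; exists w.
  exists j; first by rewrite mem_iota /= add0n ltnS ltnW.
  rewrite /A jJ -bigcup_seq; exists (w, (k, i, b)) => //=.
  by apply: allpairs_f => //; rewrite mem_enum.
apply: le_trans (lebn_cover_le mA cov) _.
rewrite -addn1 iotaD big_cat /= add0n big_seq1 /A ltnn addrC EFinD; apply: leeD.
  apply: (@lebn_cover_const _ _ _ (cells J)
    (fun w => box (fun i => ctr kap ((w : index) i)) (fun=> (3 + kap^-1) * K J))).
  - by move=> w; exact: measurable_box.
  - by move=> z; rewrite /A0 -bigcup_seq => -[w /= wJ zw]; exists w.
  - move=> w _; rewrite lebn_box.
      by rewrite prodr_const card_ord.
    by move=> _; rewrite mulr_ge0 ?addr_ge0 ?invr_ge0// ltW.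
rewrite -sumEFin -(big_mkord xpredT (fun j => ((size (cells (n := n) j) * (4 * n * 2))%:R *
      (4 * r * ((kap^-1 + 4) * K j) ^+ m.+1))%:E)) /index_iota subn0.
rewrite big_seq [leRHS]big_seq; apply: lee_sum => j; rewrite mem_iota /= add0n => jJ.
rewrite jJ.
have -> : (size (cells (n := n) j) * (4 * n * 2))%N = size (L j).
  by rewrite size_allpairs -cardE !card_prod !card_ord card_bool.
apply: (@lebn_cover_const _ _ _ (L j) (F j)).
- by move=> p; exact: measurable_box.
- by move=> z; rewrite -bigcup_seq => -[p /= pL zp]; exists p.
- move=> p _; apply: lebn_face; first exact: ltW.
  by apply: le_trans rJ (kapX_le kap0 kap12 (ltnW jJ)).
Qed.

End MinkowskiUpper.

Section MinkowskiDim.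
Context {R : realType} {m : nat}.
Local Notation n := m.+2.
Variables kap s alpha lam : R.
Hypothesis par : admissible kap s alpha.
Hypothesis kap_lam : (2 : R) ^+ n * kap `^ lam = 1.
Hypotheses (lam1 : n%:R - 1 <= lam) (lamn : lam < n%:R).

Local Notation K j := (kap ^+ j).
Local Notation G := (@apartments R m kap s alpha).

(** The thickened faces of generation j have volume of order r (K j)^(n-1-lam), with exponent at
    most 0 because lam >= n-1. So each generation below J contributes at most the order of (K
    J)^(n-lam), which is also that of the ancestor boxes. *)
Lemma lebn_nbhd_boundary_le : exists C1 C2 : R, [/\ 0 <= C1, 0 <= C2 &
  forall r J, 0 < r -> r <= K J ->
  (lebn (nbhd_set (boundary G) r) <=
    ((C1 + C2 * J%:R) * K J `^ (n%:R - lam))%:E)%E].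
Proof.
have [kap0 kap12 _ _ _] := par.
have ki0 : 0 < kap^-1 by rewrite invr_gt0.
pose C1 : R := (2 * (3 + kap^-1)) ^+ n.
pose C2 : R := (4 * n * 2)%:R * 4 * (kap^-1 + 4) ^+ m.+1.
have C10 : 0 <= C1 by rewrite exprn_ge0//; lra.
have C20 : 0 <= C2 by rewrite !mulr_ge0// exprn_ge0//; lra.
exists C1, C2; split=> // r J r0 rJ.
have KJ0 := K_gt0 par J.
apply: le_trans (lebn_nbhd_boundary par r0 rJ) _; rewrite lee_fin [leRHS]mulrDl.
apply: lerD.
  have -> : (2 * ((3 + kap^-1) * K J)) ^+ n = C1 * K J `^ n%:R.
    by rewrite powR_mulrn ?(ltW KJ0)// /C1 -exprMn mulrA.
  by rewrite mulrCA (count_cells par kap_lam).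
apply: (@le_trans _ _ (\sum_(j < J) C2 * K J `^ (n%:R - lam))).
  apply: ler_sum => j _; have Kj0 := K_gt0 par j.
  have -> : (size (cells (n := n) j) * (4 * n * 2))%:R *
      (4 * r * ((kap^-1 + 4) * K j) ^+ m.+1) =
      C2 * (r * ((size (cells (n := n) j))%:R * K j `^ m.+1%:R)).
    by rewrite powR_mulrn ?(ltW Kj0)// /C2 exprMn natrM; ring.
  rewrite ler_wpM2l// (count_cells par kap_lam).
  have -> : K J `^ (n%:R - lam) = K J * K J `^ (m.+1%:R - lam).
    rewrite -{2}(powRr1 (ltW KJ0)) -powRD; last by rewrite (gt_eqF KJ0) implybT.
    by congr (_ `^ _); rewrite -[n]addn1 natrD; ring.
  apply: ler_pM => //; [exact: ltW|exact: powR_ge0|].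
  apply: ler_powR_neg => //; first by apply: kapX_le => //; exact: ltnW.
  by move: lam1; rewrite -[n]addn1 natrD; lra.
by rewrite sumr_const card_ord -[leLHS]mulr_natl mulrA (mulrC _ C2).
Qed.

Lemma minkowski_upper x : minkowski_blowup (boundary G) x -> x <= lam.
Proof.
have [kap0 kap12 _ _ _] := par.
have ln := lamn.
move=> blow; rewrite leNgt; apply/negP => lx.
(* Capping at n keeps the exponent [mu - n%:R] at most 0, so the power of r is bounded by that of
   the smaller scale [K J.+1]. *)
pose mu := Num.min x n%:R.
have lmu : lam < mu by rewrite lt_min lx.
have mux : mu <= x by rewrite ge_min lexx.
have mun : mu <= n%:R by rewrite ge_min lexx orbT.
have [C1 [C2 [C10 C20 HC]]] := lebn_nbhd_boundary_le.
pose z := kap `^ (mu - lam).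
have z0 : 0 <= z by exact: powR_ge0.
have z1 : z < 1 by apply: powR_lt1; lra.
(* The price of passing from [K J.+1] back to [K J]. *)
pose D := kap `^ (mu - n%:R).
have D0 : 0 <= D by exact: powR_ge0.
have [r [r0 r1]] := blow (D * (C1 + C2 * (1 - z)^-1)) 1 ltr01.
apply/negP; rewrite -leNgt.
have kap1 : kap < 1 by lra.
have [J [Jr rJ]] := scale_between kap0 kap1 r0 (ltW r1).
have KJ0 := K_gt0 par J; have KJ10 := K_gt0 par J.+1.
have p0 : (0 <= (r `^ (x - n%:R))%:E)%E by rewrite lee_fin powR_ge0.
apply: le_trans (lee_wpmul2r p0 (HC r J r0 rJ)) _.
rewrite -EFinM lee_fin.
have h1 : r `^ (x - n%:R) <= D * K J `^ (mu - n%:R).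
  apply: (@le_trans _ _ (r `^ (mu - n%:R))).
    by apply: ger_powR; [rewrite r0 ltW|lra].
  apply: (@le_trans _ _ (K J.+1 `^ (mu - n%:R))).
    by apply: ler_powR_neg => //; lra.
  by rewrite exprS powRM // ltW.
apply: le_trans (ler_wpM2l _ h1) _.
  by rewrite mulr_ge0 ?powR_ge0// addr_ge0// mulr_ge0.
have -> : (C1 + C2 * J%:R) * K J `^ (n%:R - lam) * (D * K J `^ (mu - n%:R)) =
    D * (C1 * z ^+ J + C2 * (J%:R * z ^+ J)).
  have -> : z ^+ J = K J `^ (n%:R - lam) * K J `^ (mu - n%:R).
    rewrite -powRD; last by rewrite (gt_eqF KJ0) implybT.
    by rewrite /z -(K_powR par); congr (_ `^ _); ring.
  by ring.
rewrite ler_wpM2l// lerD//.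
  by rewrite ler_piMr// exprn_ile1// ltW.
by rewrite ler_wpM2l// mul_expr_le.
Qed.

Lemma minkowski_dim_apartments : minkowski_dim (boundary G) = lam%:E.
Proof.
have l1 := lam1; have lam0 : 0 < lam.
  have : 1 <= m.+1%:R :> R by rewrite ler1n.
  by move: l1; rewrite -[n]addn1 natrD; lra.
apply/eqP; rewrite eq_le; apply/andP; split.
  apply: ge_ereal_sup => _ [x [_ /minkowski_upper xl] <-].
  by rewrite lee_fin.
apply/lee_addgt0Pr => e e0.
pose x := Num.max 0 (lam - e).
have xl : x < lam by rewrite gt_max lam0 /=; lra.
apply: (@le_trans _ _ (x%:E + e%:E)%E).
  have : lam - e <= x by rewrite le_max lexx orbT.
  by rewrite -EFinD lee_fin; lra.
apply: leeD2r; apply: ereal_sup_ubound; exists x => //; split.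
  by rewrite le_max lexx.
exact: (minkowski_lower par kap_lam).
Qed.

End MinkowskiDim.

Lemma boundary_coord_le {R : realType} {n : nat} (U : set (n.-tuple R)) p i (c : R) :
  boundary U p -> (forall v, U v -> tnth v i <= c) -> tnth p i <= c.
Proof.
move=> bp Uc; apply/ler_addgt0Pr => e e0.
have [[v [Uv pv]] _] := bp e e0.
have := ler_coord_edist p v i; have := Uc v Uv.
by have := ler_norm (tnth p i - tnth v i); move: pv; lra.
Qed.

Lemma boundary_coord_ge {R : realType} {n : nat} (U : set (n.-tuple R)) p i (c : R) :
  boundary U p -> (forall v, U v -> c <= tnth v i) -> c <= tnth p i.
Proof.
move=> bp Uc; apply/ler_addgt0Pr => e e0.
have [[v [Uv pv]] _] := bp e e0.
have := ler_coord_edist p v i; have := Uc v Uv.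
by have := ler_norm (tnth v i - tnth p i); rewrite distrC; move: pv; lra.
Qed.

(** * Failure of the Poincare inequality *)

Section Ramp.
Context {R : realType}.
Variables kap : R.
Local Notation q := (unitq kap).
Local Notation K j := (kap ^+ j).

(** Rises from 0 at [q / 8] to 1 at [3 / 16 * q], in units of [K j]. This leaves a margin of
    [q / 16] to either end of the stretch from [q / 16] to [q / 4] treated by [wall]. *)
Definition ramp (j : nat) (t : R) : R :=
  Num.max 0 (Num.min 1 ((t - q / 8 * K j) * (16 / (q * K j)))).

Lemma ramp_ge0 j t : 0 <= ramp j t.
Proof. by rewrite le_max lexx. Qed.

Lemma ramp_le1 j t : ramp j t <= 1.
Proof. by rewrite ge_max ler01 ge_min lexx. Qed.

Lemma ramp_eq0 j t : 0 < q * K j -> t <= q / 8 * K j -> ramp j t = 0.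
Proof.
move=> qK tq; apply/max_idPl; rewrite ge_min; apply/orP; right.
by rewrite mulr_le0_ge0 ?divr_ge0 ?subr_le0// ltW.
Qed.

Lemma ramp_eq1 j t : 0 < q * K j -> 3 / 16 * q * K j <= t -> ramp j t = 1.
Proof.
move=> qK tq; rewrite /ramp (min_idPl _) ?(max_idPr _)//.
by rewrite mulrA ler_pdivlMr// mul1r; lra.
Qed.

Lemma ramp_lip j t t' : 0 < q * K j ->
  `|ramp j t - ramp j t'| <= 16 / (q * K j) * `|t - t'|.
Proof.
move=> qK; set L := 16 / _.
have L0 : 0 < L by rewrite divr_gt0.
wlog tt : t t' / t <= t'.
  move=> H; have [/H //|/ltW /H] := leP t t'.
  by rewrite distrC (distrC t').
have -> : L * `|t - t'| = (t' - q / 8 * K j) * L - (t - q / 8 * K j) * L.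
  by rewrite distrC ger0_norm ?subr_ge0//; ring.
rewrite /ramp -/L.
have : (t - q / 8 * K j) * L <= (t' - q / 8 * K j) * L by rewrite ler_pM2r// lerB.
move: ((t - _) * L) ((t' - _) * L) => a b ab.
have clamp (x : R) :
    Num.max 0 (Num.min 1 x) = if x <= 0 then 0 else if 1 <= x then 1 else x.
  have [x0|x0] := leP x 0.
    by apply/max_idPl; rewrite ge_min x0 orbT.
  have [x1|x1] := leP 1 x; first by apply/max_idPr.
  by apply/max_idPr/ltW.
rewrite !clamp ler_norml; apply/andP.
have [a0|a0] := leP a 0; have [b0|b0] := leP b 0;
  have [a1|a1] := leP 1 a; have [b1|b1] := leP 1 b; split; lra.
Qed.

End Ramp.

Section TestFunction.
Context {R : realType} {m : nat}.
Local Notation n := m.+2.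
Variables kap s alpha lam : R.
Hypothesis par : admissible kap s alpha.

Local Notation q := (unitq kap).
Local Notation K j := (kap ^+ j).
Local Notation index := {ffun 'I_n -> seq bool}.
Local Notation T := (piece kap s alpha 2).
Local Notation Rm := (piece kap s alpha 3).

Definition tube_room j (w : index) : set (n.-tuple R) := T j w `|` Rm j w.

(** The ramp sees only the zeroth coordinate; the indicator confines it to one tube and its room. At
    the plate the ramp is still 0, so no jump occurs there. *)
Definition tent j (w : index) (y : n.-tuple R) : R :=
  \1_(tube_room j w) y * ramp kap j (tnth y ord0 - ctr kap (w ord0)).

(* Makes the integral of the test function over the rooms of one generation
   independent of the generation. *)
Definition amplitude (j : nat) : R := K j `^ (lam - n%:R).

Definition cells_upto (J : nat) : seq (nat * index) :=
  [seq (j, w) | j <- iota 0 J, w <- cells j].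

Definition testf (J : nat) (y : n.-tuple R) : R :=
  \sum_(p <- cells_upto J) amplitude p.1 * tent p.1 p.2 y.

Lemma mem_cells_upto J j (w : index) :
  (j, w) \in cells_upto J <-> (j < J)%N /\ cell j w.
Proof.
split=> [/allpairsPdep[j' [w' [jJ /mem_cells cw [-> ->]]]]|[jJ cw]].
  by move: jJ; rewrite mem_iota.
apply: allpairs_f_dep; last exact/mem_cells.
by rewrite mem_iota.
Qed.

Lemma uniq_cells_upto J : uniq (cells_upto J).
Proof.
apply: allpairs_uniq_dep; first exact: iota_uniq.
  by move=> j _; exact: uniq_cells.
by move=> [j w] [j' w'] _ _ /= [-> ->].
Qed.

Lemma amplitude_gt0 j : 0 < amplitude j.
Proof. by apply: powR_gt0; exact: (K_gt0 par). Qed.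

Lemma qK_gt0 j : 0 < q * K j.
Proof. by apply: mulr_gt0; [exact: (q_gt0 par)|exact: (K_gt0 par)]. Qed.

Lemma width_le_q j : tube_width kap s alpha j <= q / 16 * K j.
Proof.
have [_ _ _ _ aq] := par; have K0 := K_gt0 par j.
by apply: le_trans (width_le par j) _; rewrite ler_pM2r.
Qed.

Lemma tube_room_piece j (w : index) y : tube_room j w y ->
  exists2 k, (2 <= k)%N & piece kap s alpha k j w y.
Proof. by case=> py; [exists 2|exists 3]. Qed.

Lemma tube_room_core j (w : index) y : tube_room j w y ->
  forall i, `|tnth y i - ctr kap (w i)| <= 3 / 2 * q * K j.
Proof. by move=> /tube_room_piece[k k2 py]; exact: pcenter_core py. Qed.

Lemma tube_room_core4 j (w : index) y : tube_room j w y ->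
  forall i, `|tnth y i - ctr kap (w i)| < 4 * q * K j.
Proof.
move=> hy i; apply: le_lt_trans (tube_room_core hy i) _.
by have := qK_gt0 j; lra.
Qed.

Lemma tube_room_uniq j j' (w w' : index) y : cell j w -> cell j' w' ->
  tube_room j w y -> tube_room j' w' y -> w' = w /\ j' = j.
Proof.
move=> cw cw' hy /tube_room_piece[k k2 py].
exact: apartment_uniq cw cw' (tube_room_core4 hy) k2 py.
Qed.

Lemma tent_ge0 j (w : index) y : 0 <= tent j w y.
Proof. by rewrite mulr_ge0 ?ramp_ge0// indicE. Qed.

Lemma tent_le1 j (w : index) y : tent j w y <= 1.
Proof.
by rewrite /tent indicE; case: (_ \in _); rewrite ?mul0r// mul1r ramp_le1.
Qed.

Lemma tent_out j (w : index) y : ~ tube_room j w y -> tent j w y = 0.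
Proof. by move=> hy; rewrite /tent indicE memNset// mul0r. Qed.

Lemma tent_in j (w : index) y : tube_room j w y ->
  tent j w y = ramp kap j (tnth y ord0 - ctr kap (w ord0)).
Proof. by move=> hy; rewrite /tent indicE mem_set// mul1r. Qed.

Lemma testf_tube_room J j (w : index) y : (j < J)%N -> cell j w -> tube_room j w y ->
  testf J y = amplitude j * ramp kap j (tnth y ord0 - ctr kap (w ord0)).
Proof.
move=> jJ cw hy; rewrite /testf (bigD1_seq (j, w)) ?uniq_cells_upto//=; last first.
  exact/mem_cells_upto.
rewrite tent_in// big_seq_cond big1 ?addr0// => -[j' w'] /= /andP[/mem_cells_upto[_ cw']].
move=> ne; rewrite tent_out ?mulr0// => hy'.
by have [e1 e2] := tube_room_uniq cw cw' hy hy'; move: ne; rewrite e1 e2 eqxx.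
Qed.

Lemma testf_ge0 J y : 0 <= testf J y.
Proof.
by apply: sumr_ge0 => p _; rewrite mulr_ge0 ?tent_ge0// ltW// amplitude_gt0.
Qed.

End TestFunction.

Section PairDifference.
Context {R : realType} {m : nat}.
Local Notation n := m.+2.
Variables kap s alpha lam tau : R.
Hypothesis par : admissible kap s alpha.
Hypotheses (tau0 : 0 < tau) (tau1 : tau < 1).
Hypothesis alpha_tau : alpha * (2 * n%:R) <= unitq kap / 32 * (1 - tau).

Local Notation q := (unitq kap).
Local Notation K j := (kap ^+ j).
Local Notation index := {ffun 'I_n -> seq bool}.
Local Notation G := (@apartments R m kap s alpha).
Local Notation i1 := (lift ord0 ord0 : 'I_n).
Local Notation T := (piece kap s alpha 2).
Local Notation hall := (tube_room kap s alpha).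
Local Notation bump := (tent kap s alpha).
Local Notation width := (tube_width kap s alpha).

(** The part of tube and room beyond the plate. Inside [G] it can only be left through the slice at
    level [q / 16]. *)
Definition inner_room j (w : index) : set (n.-tuple R) :=
  [set y | hall j w y /\ q / 16 * K j < tnth y ord0 - ctr kap (w ord0)].

Lemma eopen_inner_room j (w : index) : eopen (inner_room j w).
Proof.
move=> y [hy yq].
pose e1 := tnth y ord0 - ctr kap (w ord0) - q / 16 * K j.
have e10 : 0 < e1 by rewrite subr_gt0.
have [e e0 ehall] : exists2 e, 0 < e & eball y e `<=` hall j w.
  have [k k2 py] := tube_room_piece hy.
  case: hy => py'; have [e e0 ep] := eopen_box py'; exists e => // z /ep pz.
    by left.
  by right.
exists (Num.min e e1); first by rewrite lt_min e0.
move=> z; rewrite /eball /= lt_min => /andP[z1 z2]; split; first exact: ehall.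
have := ler_coord_edist y z ord0.
by have := ler_norm (tnth y ord0 - tnth z ord0); move: z2; rewrite /e1; lra.
Qed.

(** The exit point satisfies the closed versions of the inequalities of the inner room, so
    [isolation] puts it in the tube or room of the same cell. Being outside the open inner room, it
    is exactly at level [q / 16], where [wall] supplies a point of the complement. *)
Lemma inner_room_exit j (w : index) x y : cell j w ->
  (forall t, 0 <= t -> t <= 1 -> G (seg x y t)) ->
  inner_room j w x -> ~ inner_room j w y ->
  exists t z', [/\ 0 <= t <= 1, ~ G z',
    tnth (seg x y t) ord0 - ctr kap (w ord0) = q / 16 * K j &
    edist (seg x y t) z' <= n%:R * (2 * width j)].
Proof.
have wq := width_le_q par j; have qK := qK_gt0 par j.
move=> cw Gxy Ux Uy; have [t [t0 t1 bt]] := seg_exit (@eopen_inner_room j w) Ux Uy.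
set p := seg x y t in bt *.
have p0 : q / 16 * K j <= tnth p ord0 - ctr kap (w ord0).
  suff : ctr kap (w ord0) + q / 16 * K j <= tnth p ord0 by lra.
  by apply: (boundary_coord_ge bt) => v [_]; lra.
have p1 : q / 16 * K j <= tnth p i1 - ctr kap (w i1).
  suff : ctr kap (w i1) + q / 16 * K j <= tnth p i1 by lra.
  apply: (boundary_coord_ge bt) => v [[] pv _]; have := pv i1;
    rewrite /pcenter /= ltr_norml => /andP[h _]; move: h wq qK; lra.
have pc i : `|tnth p i - ctr kap (w i)| < 4 * q * K j.
  have h1 : tnth p i <= ctr kap (w i) + 3 / 2 * q * K j.
    apply: (boundary_coord_le bt) => v [hv _]; have := tube_room_core par hv i.
    by rewrite ler_norml => /andP[_]; lra.
  have h2 : ctr kap (w i) - 3 / 2 * q * K j <= tnth p i.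
    apply: (boundary_coord_ge bt) => v [hv _]; have := tube_room_core par hv i.
    by rewrite ler_norml => /andP[]; lra.
  by rewrite ltr_norml; apply/andP; split; move: qK; lra.
have [k [k2 pk]] := isolation par cw pc p0 p1 (Gxy t t0 t1).
have nUp := boundary_notin (@eopen_inner_room j w) bt.
have pT : hall j w p -> tnth p ord0 - ctr kap (w ord0) = q / 16 * K j.
  move=> hp; apply/eqP; rewrite eq_le p0 andbT leNgt; apply/negP => lt.
  exact: nUp.
have hp : hall j w p.
  case: k k2 pk => [|[|[|k]]]//= _ pk; first by left.
  by right.
have pe := pT hp.
have pTw : T j w p.
  case: hp => // pR; have := pR ord0; rewrite /pcenter /= ltr_norml => /andP[h _].
  by move: h qK; lra.
have [|i i0|z' [Gz' pz']] := @wall R m kap s alpha par j w p cw p0 _ _.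
- by rewrite pe; move: qK; lra.
- by have := pTw i; rewrite /= (negbTE i0) => /ltW.
by exists t, z'; rewrite t0 t1.
Qed.

Lemma width_scaled j : n%:R * (2 * width j) <= q / 32 * K j * (1 - tau).
Proof.
have K0 := K_gt0 par j.
apply: (@le_trans _ _ (alpha * (2 * n%:R) * K j)).
  rewrite (_ : alpha * _ * _ = n%:R * (2 * (alpha * K j))); last by ring.
  by rewrite ler_pM2l// ler_pM2l// (width_le par).
by rewrite [leRHS]mulrAC ler_pM2r.
Qed.

Lemma tent_zero j (w : index) x :
  tnth x ord0 - ctr kap (w ord0) <= q / 8 * K j -> bump j w x = 0.
Proof.
move=> xq; rewrite /tent ramp_eq0 ?mulr0//; exact: (qK_gt0 par).
Qed.

Lemma tent_not_inner j (w : index) x : ~ inner_room j w x -> bump j w x = 0.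
Proof.
have qK := qK_gt0 par j.
move=> nU; have [hx|] := pselect (hall j w x); last exact: tent_out.
apply: tent_zero; have [|lt] := leP (tnth x ord0 - ctr kap (w ord0)) (q / 16 * K j).
  by move: qK; lra.
by exfalso; apply: nU.
Qed.

Lemma edist_seg_left (x y : n.-tuple R) t : 0 <= t -> t <= 1 ->
  edist x (seg x y t) <= edist x y.
Proof.
move=> t0 t1; rewrite -{1}(seg0 x y) edist_seg sub0r normrN ger0_norm//.
by rewrite ler_piMl// edist_ge0.
Qed.

Lemma edist_seg_right (x y : n.-tuple R) t : 0 <= t -> t <= 1 ->
  edist y (seg x y t) <= edist x y.
Proof.
move=> t0 t1; rewrite -{1}(seg1 x y) edist_seg ger0_norm ?subr_ge0//.
by rewrite ler_piMl// ?edist_ge0//; lra.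
Qed.

(** The distance d of [x] to the boundary is at most [tau * d] plus the distance from the crossing
    point to [z'], so [width_scaled] gives d <= q/32 K j. Both points are then below q/16 + q/32 <
    q/8 in units of [K j], where the ramp vanishes. *)
Lemma crossing_small j (w : index) x y t z' : G x ->
  edist x y < tau * dist_set x (boundary G) ->
  edist x (seg x y t) <= edist x y -> edist y (seg x y t) <= edist x y ->
  ~ G z' -> tnth (seg x y t) ord0 - ctr kap (w ord0) = q / 16 * K j ->
  edist (seg x y t) z' <= n%:R * (2 * width j) ->
  bump j w x = 0 /\ bump j w y = 0.
Proof.
have oG := @apartments_open R m kap s alpha.
move=> Gx xy xp yp Gz' pq pz'; have qK := qK_gt0 par j.
have K0 := K_gt0 par j.
have d1 := dist_boundary_le oG Gx Gz'.
have d2 := edist_triangle (seg x y t) x z'.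
set d := dist_set x (boundary G) in xy d1 *.
have w1 := width_scaled j.
have dq : d <= q / 32 * K j.
  have t1 : 0 < 1 - tau by rewrite subr_gt0.
  rewrite -(ler_pM2r t1) mulrBr mulr1; move: w1 xy d1 d2 xp pz'.
  by rewrite (mulrC d); lra.
have dd : 0 <= d.
  have := edist_ge0 x y; have t0 := tau0 => e0.
  by rewrite -(pmulr_rge0 _ t0) ltW// (le_lt_trans e0).
have td : tau * d <= d by rewrite ler_piMl// ltW// tau1.
have cx := ler_coord_edist x (seg x y t) ord0.
have cy := ler_coord_edist y (seg x y t) ord0.
have nx := ler_norm (tnth x ord0 - tnth (seg x y t) ord0).
have ny := ler_norm (tnth y ord0 - tnth (seg x y t) ord0).
by split; apply: tent_zero; move: qK; lra.
Qed.

Lemma seg_in_apartments x y : G x ->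
  edist x y < tau * dist_set x (boundary G) ->
  forall t, 0 <= t -> t <= 1 -> G (seg x y t).
Proof.
have oG := @apartments_open R m kap s alpha.
move=> Gx xy t t0 t1; apply: (eball_dist_boundary oG Gx); rewrite /eball /=.
apply: le_lt_trans (edist_seg_left x y t0 t1) (lt_le_trans xy _).
have e0 := edist_ge0 x y; have tp := tau0.
have dd : 0 <= dist_set x (boundary G).
  by rewrite -(pmulr_rge0 _ tp) ltW//; exact: le_lt_trans xy.
by apply: ler_piMl => //; exact: ltW.
Qed.

Lemma seg_rev (x y : n.-tuple R) t : seg y x t = seg x y (1 - t).
Proof. by apply: eq_from_tnth => i; rewrite !tnth_mktuple; ring. Qed.

(* A segment which leaves the inner room does so through the narrow beginning of
   the tube; the ball is then too small to reach the part where the ramp varies. *)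
Lemma tent_diff j (w : index) x y : cell j w -> G x ->
  edist x y < tau * dist_set x (boundary G) ->
  bump j w x != bump j w y -> inner_room j w x /\ inner_room j w y.
Proof.
move=> cw Gx xy /eqP ne.
have Gs := seg_in_apartments Gx xy.
have [Ux|nUx] := pselect (inner_room j w x); have [Uy|nUy] := pselect (inner_room j w y) => //.
- have [t [z' [/andP[t0 t1] Gz' pq pz']]] := inner_room_exit cw Gs Ux nUy.
  have [e1 e2] := crossing_small Gx xy (edist_seg_left x y t0 t1)
    (edist_seg_right x y t0 t1) Gz' pq pz'.
  by case: ne; rewrite e1 e2.
- have Gs' t : 0 <= t -> t <= 1 -> G (seg y x t).
    by move=> t0 t1; rewrite seg_rev; apply: Gs; lra.
  have [t [z' [/andP[t0 t1] Gz' pq pz']]] := inner_room_exit cw Gs' Uy nUx.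
  have t10 : 0 <= 1 - t by lra.
  have t11 : 1 - t <= 1 by lra.
  rewrite seg_rev in pq pz'.
  have [e1 e2] := crossing_small Gx xy (edist_seg_left x y t10 t11)
    (edist_seg_right x y t10 t11) Gz' pq pz'.
  by case: ne; rewrite e1 e2.
- by case: ne; rewrite !tent_not_inner.
Qed.

(** As in [crossing_small], a wall near the ball bounds d by the order of the width over 1 - tau.
    The centre is then within [q / 32 * K j] of a point below level [3 / 16 * q], hence in front of
    the room. *)
Lemma tent_diff_tube j (w : index) x y : cell j w -> G x ->
  edist x y < tau * dist_set x (boundary G) ->
  bump j w x != bump j w y ->
  [/\ T j w x, hall j w y & edist x y < n%:R * (2 * width j) / (1 - tau)].
Proof.
have oG := @apartments_open R m kap s alpha.
move=> cw Gx xy ne; have [[hx xq] [hy yq]] := tent_diff cw Gx xy ne.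
have qK := qK_gt0 par j; have t1p : 0 < 1 - tau by rewrite subr_gt0.
have tp := tau0.
set d := dist_set x (boundary G) in xy *.
have w1 := width_scaled j.
have e0 := edist_ge0 x y.
have dd : 0 <= d by rewrite -(pmulr_rge0 _ tp) ltW//; exact: le_lt_trans xy.
have td : tau * d <= d by rewrite ler_piMl// ltW.
have tubes z : hall j w z -> tnth z ord0 - ctr kap (w ord0) < q / 4 * K j -> T j w z.
  move=> [//|zR] zq; have := zR ord0; rewrite /pcenter /= ltr_norml => /andP[h _].
  by move: h zq qK; lra.
(* With both points beyond [3 / 16 * q] both tents would be 1; so one endpoint lies where [wall]
   applies. *)
have small : exists z, [/\ T j w z, edist x z <= edist x y,
    q / 16 * K j <= tnth z ord0 - ctr kap (w ord0) &
    tnth z ord0 - ctr kap (w ord0) < 3 / 16 * q * K j].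
  have [lx|gx] := ltP (tnth x ord0 - ctr kap (w ord0)) (3 / 16 * q * K j).
    exists x; rewrite edistxx; split=> //; last exact: ltW.
    by apply: tubes => //; move: qK; lra.
  have [ly|gy] := ltP (tnth y ord0 - ctr kap (w ord0)) (3 / 16 * q * K j).
    exists y; split=> //; last exact: ltW.
    by apply: tubes => //; move: qK; lra.
  by move/eqP: ne; rewrite !tent_in// !ramp_eq1.
have [z [zT xz zl zu]] := small.
have [|i i0|z' [Gz' zz']] := @wall R m kap s alpha par j w z cw zl _ _.
- by move: zu qK; lra.
- by have := zT i; rewrite /= (negbTE i0) => /ltW.
have d1 := dist_boundary_le oG Gx Gz'.
have d2 := edist_triangle z x z'.
rewrite -/d in d1.
have dle : d * (1 - tau) <= n%:R * (2 * width j).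
  by rewrite mulrBr mulr1 (mulrC d); lra.
have dq : d <= q / 32 * K j.
  by rewrite -(ler_pM2r t1p); exact: le_trans dle w1.
split=> //.
  apply: tubes => //.
  have cx := ler_coord_edist x z ord0.
  have nx := ler_norm (tnth x ord0 - tnth z ord0).
  by move: qK; lra.
rewrite ltr_pdivlMr//; apply: lt_le_trans dle; rewrite ltr_pM2r//.
exact: lt_le_trans xy td.
Qed.

Lemma testf_diff J x y : G x ->
  edist x y < tau * dist_set x (boundary G) ->
  testf kap s alpha lam J x != testf kap s alpha lam J y ->
  exists j (w : index), [/\ (j < J)%N, cell j w, T j w x,
    edist x y < n%:R * (2 * width j) / (1 - tau) &
    `|testf kap s alpha lam J x - testf kap s alpha lam J y| <=
      amplitude (m := m) kap lam j * (16 / (q * K j)) * edist x y].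
Proof.
move=> Gx xy ne.
have [[j w] [/mem_cells_upto[jJ cw] nb]] : exists p : nat * index,
    p \in cells_upto J /\ bump p.1 p.2 x != bump p.1 p.2 y.
  apply: contrapT => H; move/eqP: ne; apply.
  rewrite /testf big_seq [RHS]big_seq; apply: eq_bigr => p pJ; congr (_ * _).
  by apply/eqP/negPn/negP => nb; apply: H; exists p.
have [xT hy exy] := tent_diff_tube cw Gx xy nb.
exists j, w; split=> //.
have hx : hall j w x by left.
rewrite !(testf_tube_room lam par jJ cw)// -mulrBr normrM gtr0_norm ?(amplitude_gt0 (m := m) lam par)//.
rewrite -mulrA ler_pM2l ?(amplitude_gt0 (m := m) lam par)//.
have qK := qK_gt0 par j.
apply: le_trans (ramp_lip _ _ qK) _.
rewrite ler_pM2l ?divr_gt0//.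
rewrite (_ : _ - _ = tnth x ord0 - tnth y ord0); last by ring.
exact: ler_coord_edist.
Qed.

End PairDifference.

(** * Integral estimates *)

Lemma integral_indicZ d (T : measurableType d) (R : realType)
    (mu : {measure set T -> \bar R}) (c : R) (A : set T) : 0 <= c -> measurable A ->
  (\int[mu]_x (c * \1_A x)%:E = c%:E * mu A)%E.
Proof.
move=> c0 mA; under eq_integral => x _ do rewrite EFinM.
rewrite ge0_integralZl ?lee_fin//; first by rewrite integral_indic ?setIT.
exact/measurable_EFinP/measurable_indic.
Qed.

Lemma ge0_integral_indic_sum (R : realType) n (I : Type) (r : seq I) (c : I -> R)
    (F : I -> set (n.-tuple R)) :
  (forall i, 0 <= c i) -> (forall i, measurable (F i)) ->
  (\int[@lebn R n]_x (\sum_(i <- r) c i * \1_(F i) x)%:E =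
   \sum_(i <- r) (c i)%:E * lebn (F i))%E.
Proof.
have [mu ->] := lebn_measure R n; move=> c0 mF.
under eq_integral => x _ do rewrite -sumEFin.
rewrite ge0_integral_sum//.
- by apply: eq_bigr => i _; exact: integral_indicZ.
- move=> i; apply/measurable_EFinP; apply: measurable_funM => //.
- by move=> i x _; rewrite lee_fin mulr_ge0// indicE.
Qed.

(* The ball is covered by dyadic shells, on each of which the kernel is
   comparable to a constant. *)
Lemma singular_integral_le (R : realType) n (p e : R) : 0 < p -> 0 <= e -> e < n%:R + p ->
  exists2 C : R, 0 <= C & forall (x : n.-tuple R) (D L : R) (E : set (n.-tuple R)) f,
    0 < D -> 0 <= L -> (forall y, E y -> 0 <= f y) ->
    (forall y, E y -> f y != 0 ->
      edist x y < D /\ f y <= L * (edist x y `^ p / edist x y `^ e)) ->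
    (\int[lebn (n:=n)]_(y in E) (f y)%:E <= (L * C * D `^ (n%:R + p - e))%:E)%E.
Proof.
move=> p0 e0 pe; pose h : R := 2^-1.
have h0 : 0 < h by rewrite invr_gt0.
have h1 : h < 1 by rewrite /h invf_lt1// ltr1n.
set d := n%:R + p - e; have d0 : 0 < d by rewrite /d; lra.
have hd1 : h `^ d < 1 by exact: powR_lt1.
have hd0 : 0 < 1 - h `^ d by rewrite subr_gt0.
have he0 : 0 < h `^ e by exact: powR_gt0.
(* The volume factor of the box around a shell, the ratio of its radii in the denominator, and a
   geometric series of ratio h^d, where d > 0 is the assumption on [e]. *)
pose C : R := 4 ^+ n / h `^ e / (1 - h `^ d).
have C0 : 0 <= C by rewrite !divr_ge0// ltW.
exists C => // x D L E f D0 L0 f0 fE.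
(* Bound on the shell between the radii h^(k+1) D and h^k D: the outer radius in the numerator, the
   inner one in the denominator. *)
pose M k := L * ((h ^+ k * D) `^ p / (h ^+ k.+1 * D) `^ e).
pose B k := box (tnth x) (fun _ : 'I_n => 2 * (h ^+ k * D)).
have hk0 k : 0 < h ^+ k by exact: exprn_gt0.
have hkD k : 0 < h ^+ k * D by exact: mulr_gt0.
have M0 k : 0 <= M k by rewrite mulr_ge0// divr_ge0// powR_ge0.
have [mu muE] := lebn_measure R n.
have MB k : ((M k)%:E * lebn (B k))%E =
    (L * (4 ^+ n / h `^ e) * D `^ d * (h `^ d) ^+ k)%:E.
  rewrite lebn_box => [|_]; last by rewrite mulr_ge0// ltW.
  rewrite prodr_const card_ord -EFinM; congr (_%:E).
  rewrite -powRX ?(ltW h0)// -[in LHS]mulrA -!mulrA; congr (L * _).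
  rewrite exprS -(mulrA h) (@powRM _ h (h ^+ k * D) e) ?(ltW h0) ?(ltW (hkD k))//.
  have hne : h `^ e != 0 by rewrite gt_eqF.
  have kne : (h ^+ k * D) `^ e != 0 by rewrite gt_eqF ?powR_gt0.
  rewrite (_ : 2 * (2 * (h ^+ k * D)) = 4 * (h ^+ k * D)); last by ring.
  rewrite (exprMn n 4).
  have -> : D `^ d * (h ^+ k) `^ d = (h ^+ k * D) `^ p * (h ^+ k * D) ^+ n / (h ^+ k * D) `^ e.
    rewrite mulrC -powRM ?(ltW (hk0 k)) ?(ltW D0)// -[_ ^+ n]powR_mulrn ?(ltW (hkD k))//.
    rewrite -powRD; last by rewrite (gt_eqF (hkD k)) implybT.
    rewrite -powRB; last by rewrite (gt_eqF (hkD k)) implybT.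
    by rewrite /d; congr (_ `^ _); ring.
  by rewrite invfM; ring.
pose g y := (\sum_(k <oo) (M k * \1_(B k) y)%:E)%E.
have g_ge0 k y : (0 <= (M k * \1_(B k) y)%:E)%E by rewrite lee_fin mulr_ge0// indicE.
have fg y : E y -> ((f y)%:E <= g y)%E.
  move=> Ey; have [->|fN0] := eqVneq (f y) 0; first exact: nneseries_ge0.
  have [xyD fle] := fE y Ey fN0.
  have xy0 : 0 < edist x y.
    rewrite lt_neqAle edist_ge0 andbT; apply/eqP => xy.
    move: fle fN0; rewrite -xy (powR0 (negbT (gt_eqF p0))) mul0r mulr0 => fle.
    by rewrite eq_le fle f0.
  have [|k [k1 k2]] := @scale_between _ h (edist x y / D) h0 h1 (divr_gt0 xy0 D0).
    by rewrite ler_pdivrMr// mul1r ltW.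
  rewrite ler_pdivlMr// in k1; rewrite ler_pdivrMr// in k2.
  have By : B k y.
    move=> i; rewrite distrC; apply: le_lt_trans (ler_coord_edist x y i) _.
    by apply: le_lt_trans k2 _; rewrite ltr_pMl// ltr1n.
  have fM : f y <= M k.
    apply: le_trans fle _; rewrite /M ler_wpM2l//.
    apply: ler_pM; rewrite ?invr_ge0 ?powR_ge0//.
      by apply: ge0_ler_powR => //; rewrite ?nnegrE ltW.
    rewrite lef_pV2 ?posrE ?powR_gt0//.
    by apply: ge0_ler_powR => //; rewrite ?nnegrE ltW.
  apply: (@le_trans _ _ (\sum_(0 <= i < k.+1) (M i * \1_(B i) y)%:E)%E); last first.
    exact: nneseries_lim_ge.
  rewrite big_nat_recr//= indicE mem_set// mulr1.
  apply: le_trans (_ : ((M k)%:E <= _)%E); first by rewrite lee_fin.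
  by rewrite leeDr// sume_ge0.
apply: (@le_trans _ _ (\int[lebn (n:=n)]_y g y)%E).
  rewrite muE; apply: ge0_le_integral_subset.
  - by move=> y Ey; rewrite lee_fin f0.
  - by move=> y _; exact: nneseries_ge0.
  - by move=> y Ey; split=> //; exact: fg.
have -> : (\int[lebn (n:=n)]_y g y = \sum_(k <oo) ((M k)%:E * lebn (B k)))%E.
  rewrite muE integral_nneseries//; last first.
    move=> k; apply/measurable_EFinP; apply: measurable_funM => //.
    by apply: measurable_indic; exact: measurable_box.
  by apply: eq_eseriesr => k _; apply: integral_indicZ => //; exact: measurable_box.
have MB0 k : (0 <= (M k)%:E * lebn (B k))%E.
  by rewrite MB lee_fin !mulr_ge0 ?exprn_ge0 ?powR_ge0 ?invr_ge0 ?powR_ge0.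
apply: lime_le; first exact: is_cvg_nneseries.
apply: nearW => N; under eq_bigr => k _ do rewrite MB.
rewrite sumEFin lee_fin big_mkord -mulr_sumr.
have -> : L * C * D `^ d = L * (4 ^+ n / h `^ e) * D `^ d * (1 - h `^ d)^-1.
  by rewrite /C; ring.
rewrite ler_wpM2l//.
  by rewrite !mulr_ge0 ?exprn_ge0 ?powR_ge0 ?invr_ge0 ?powR_ge0.
rewrite -(ler_pM2l hd0) divff ?gt_eqF// -opprB mulNr -subrX1.
by rewrite opprB gerBl exprn_ge0// powR_ge0.
Qed.

Lemma linear_not_le_root (R : realType) (a B p : R) : 0 < a -> 0 <= B -> 1 < p ->
  ~ (forall J : nat, J%:R * a <= B * J%:R `^ p^-1).
Proof.
move=> a0 B0 p1 H; have pV : p^-1 < 1 by rewrite invf_lt1//; lra.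
pose r := 1 - p^-1; have r0 : 0 < r by rewrite subr_gt0.
(* For J beyond [X], J^(1 - 1/p) exceeds (B + 1) / a. *)
pose X := ((B + 1) / a) `^ r^-1.
have X0 : 0 <= X by exact: powR_ge0.
have [J XJ] : exists J : nat, X < J%:R.
  by exists (Num.bound X); rewrite (le_lt_trans (ler_norm X))// ger0_norm// archi_boundP.
have J0 : 0 < J%:R :> R by exact: le_lt_trans XJ.
have E : J%:R = J%:R `^ r * J%:R `^ p^-1 :> R.
  rewrite -powRD; last by rewrite (gt_eqF J0) implybT.
  by rewrite /r subrK powRr1// ltW.
have := H J; rewrite {1}E mulrAC ler_pM2r ?powR_gt0//.
apply/negP; rewrite -ltNge.
apply: (@lt_le_trans _ _ (B + 1)); first by rewrite ltrDl.
rewrite -ler_pdivrMr//.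
have -> : (B + 1) / a = X `^ r.
  by rewrite /X -powRrM mulVf ?gt_eqF// powRr1//; apply: divr_ge0; lra.
by apply: ge0_ler_powR; rewrite ?nnegrE// ltW.
Qed.

Section TestFunctionIntegral.
Context {R : realType} {m : nat}.
Local Notation n := m.+2.
Variables kap s alpha lam p : R.
Hypothesis par : admissible kap s alpha.
Hypothesis kap_lam : (2 : R) ^+ n * kap `^ lam = 1.
Hypothesis p1 : 1 < p.

Local Notation q := (unitq kap).
Local Notation K j := (kap ^+ j).
Local Notation index := {ffun 'I_n -> seq bool}.
Local Notation G := (@apartments R m kap s alpha).
Local Notation Rm := (piece kap s alpha 3).
Local Notation hall := (tube_room kap s alpha).
Local Notation amp := (amplitude (m := m) kap lam).
Local Notation u := (testf (m := m) kap s alpha lam).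
Local Notation allcells := (@cells_upto m).

Lemma sum_cells_upto J (f : nat -> R) :
  \sum_(c <- allcells J) f c.1 = \sum_(j < J) (size (cells (n := n) j))%:R * f j.
Proof.
rewrite /cells_upto big_allpairs_dep /=.
rewrite -(big_mkord xpredT (fun j => (size (cells (n := n) j))%:R * f j)).
rewrite /index_iota subn0; apply: eq_bigr => j _.
by rewrite big_const_seq count_predT iter_addr_0 mulr_natl.
Qed.

Definition big_half : R := 2 + (2 * kap)^-1.

Definition volume_bound : R := (2 * big_half) ^+ n.

Lemma big_half_gt0 : 0 < big_half.
Proof.
have [kap0 _ _ _ _] := par.
by rewrite addr_gt0// invr_gt0 mulr_gt0.
Qed.

Definition big_box : set (n.-tuple R) := box (fun=> 0) (fun=> big_half).

Lemma lebn_big_box : lebn big_box = volume_bound%:E.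
Proof.
have b0 := big_half_gt0.
by rewrite lebn_box ?prodr_const ?card_ord// => _; exact: ltW.
Qed.

Lemma apartments_sub_big_box : G `<=` big_box.
Proof.
move=> x Gx i; rewrite subr0; apply: le_lt_trans (apartments_bound par i Gx) _.
by rewrite /big_half ltrD2r ltr1n.
Qed.

Lemma integral_bounded (f : n.-tuple R -> R) (M : R) :
  (forall x, 0 <= f x) -> (forall x, f x <= M) ->
  (\int[lebn (n:=n)]_(x in G) (f x)%:E <= (M * volume_bound)%:E)%E.
Proof.
have [mu muE] := lebn_measure R n; move=> f0 fM; rewrite muE.
apply: (@le_trans _ _ (\int[mu]_(x in big_box) (cst M%:E x))%E).
  apply: ge0_le_integral_subset => x Gx /=.
  - by rewrite lee_fin.
  - by rewrite lee_fin (le_trans (f0 x)).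
  - by split; [exact: apartments_sub_big_box|rewrite lee_fin].
rewrite integral_cst; last exact: measurable_box.
by rewrite EFinM -lebn_big_box muE.
Qed.

Definition amplitude_total (J : nat) : R := \sum_(c <- allcells J) amp c.1.

Lemma testf_le J x : u J x <= amplitude_total J.
Proof.
apply: ler_sum => c _; rewrite ler_piMr ?tent_le1//.
by rewrite ltW// (amplitude_gt0 (m := m) lam par).
Qed.

Lemma measurable_testf J : measurable_fun [set: n.-tuple R] (u J).
Proof.
apply: measurable_sum => c; apply: measurable_funM => //.
apply: measurable_funM.
  by apply: measurable_indic; apply: measurableU; exact: measurable_box.
apply: measurable_maxr => //; apply: measurable_minr => //.
apply: measurable_funM => //; do 2 apply: measurable_funB => //.
exact: measurable_tnth.
Qed.

Lemma testf_Lp J : in_Lp G p (u J).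
Proof.
split; first by apply: measurable_funTS; exact: measurable_testf.
apply: le_lt_trans (_ : ((amplitude_total J `^ p * volume_bound)%:E < +oo)%E); last exact: ltry.
apply: integral_bounded => x; first exact: powR_ge0.
have u0 := testf_ge0 lam par J x.
rewrite ger0_norm//; apply: ge0_ler_powR; rewrite ?nnegrE//.
- by move: p1; lra.
- exact: le_trans u0 (testf_le J x).
- exact: testf_le.
Qed.

(** Only rooms are counted, where the ramp is 1. In generation j, their number (K j)^(-lam), the
    amplitude (K j)^(lam-n) and the room volume (q/2 K j)^n multiply to (q/2)^n. *)
Lemma integral_testf_ge J :
  ((J%:R * (q / 2) ^+ n)%:E <= \int[lebn (n:=n)]_(x in G) (u J x)%:E)%E.
Proof.
pose lo x := \sum_(c <- allcells J) amp c.1 * \1_(Rm c.1 c.2) x.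
have amp0 j : 0 < amp j := amplitude_gt0 (m := m) lam par j.
have lo0 x : 0 <= lo x by apply: sumr_ge0 => c _; rewrite mulr_ge0 ?indicE// ltW.
have qK j := qK_gt0 par j.
have lou x : lo x <= u J x.
  apply: ler_sum => c _; rewrite ler_pM2l//.
  have [hR|nR] := pselect (Rm c.1 c.2 x); last first.
    by rewrite indicE memNset// tent_ge0.
  rewrite indicE mem_set// tent_in; last by right.
  rewrite ramp_eq1//; have := hR ord0; rewrite /pcenter /= ltr_norml => /andP[h _].
  by move: h (qK c.1); lra.
have losub x : lo x != 0 -> G x.
  move=> ne; apply: contrapT => nG; move/eqP: ne; apply.
  rewrite /lo big_seq; apply: big1 => -[j w] /mem_cells_upto[_ cw] /=.
  by rewrite indicE memNset ?mulr0// => /(piece_sub cw).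
have <- : (\int[lebn (n:=n)]_x (lo x)%:E = (J%:R * (q / 2) ^+ n)%:E)%E.
  rewrite ge0_integral_indic_sum; last 2 first.
  - by move=> c; exact: ltW.
  - by move=> c; exact: measurable_box.
  rewrite (eq_bigr (fun c => (amp c.1 * (q / 2 * K c.1) ^+ n)%:E)); last first.
    move=> c _; rewrite lebn_box.
      rewrite EFinM /= prodr_const card_ord; congr (_ * (_ ^+ _)%:E)%E; by field.
    by move=> i /=; move: (qK c.1); lra.
  rewrite sumEFin (sum_cells_upto J (fun j => amp j * (q / 2 * K j) ^+ n)).
  congr (_%:E); rewrite (eq_bigr (fun=> (q / 2) ^+ n)).
    by rewrite sumr_const card_ord mulr_natl.
  move=> j _; have K0 := K_gt0 par j.
  rewrite mulrA (count_cells par kap_lam) exprMn -[K j ^+ n]powR_mulrn ?(ltW K0)//.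
  rewrite mulrCA -powRD; last by rewrite (gt_eqF K0) implybT.
  by rewrite (_ : lam - n%:R - lam + n%:R = 0) ?powRr0 ?mulr1//; ring.
have [mu muE] := lebn_measure R n; rewrite muE [leRHS]integral_mkcond.
apply: ge0_le_integral_subset.
- by move=> x _; rewrite lee_fin.
- by move=> x _; rewrite /patch; case: ifP => // _; rewrite lee_fin (testf_ge0 lam par).
- move=> x _; split=> //; rewrite /patch; case: ifPn => [_|]; first by rewrite lee_fin.
  rewrite notin_setE => nG; rewrite lee_fin.
  by have [->//|/losub] := eqVneq (lo x) 0.
Qed.

(** A fixed set of positive measure on which all test functions vanish, so that the deviation from
    the mean there is the mean itself. *)
Definition plate0 : set (n.-tuple R) :=
  piece kap s alpha 0 0 ([ffun => [::]] : index).

Lemma plate0_sub : plate0 `<=` G.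
Proof. exact: piece_sub (@cell_origin m). Qed.

(** The zeroth coordinate is in the core of the empty word, so only the tube and room of the root
    cell can contain the point, and it lies below the foot of the ramp. *)
Lemma testf_plate0 J x : plate0 x -> u J x = 0.
Proof.
move=> px; rewrite /testf big_seq; apply: big1 => -[j w] /mem_cells_upto[_ cw] /=.
have qK i := qK_gt0 par i.
have [hx|nx] := pselect (hall j w x); last by rewrite tent_out// mulr0.
have x0 := px ord0; rewrite /pcenter /= ffunE /= expr0 mulr1 addr0 subr0 in x0.
have := qK 0; rewrite expr0 mulr1 => q0.
have e : [::] = w ord0.
  apply: (core_uniq_unitq par (y := tnth x ord0)); last by rewrite cw; exact: (tube_room_core4 par hx).
  by rewrite /= subr0 expr0 mulr1; lra.
have j0 : j = 0 by rewrite -(cw ord0) -e.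
rewrite tent_in// ramp_eq0 ?mulr0// -e j0 /= subr0 expr0 mulr1.
by move: x0; rewrite ltr_norml => /andP[_]; lra.
Qed.

Lemma lebn_plate0 : exists2 v : R, 0 < v & lebn plate0 = v%:E.
Proof.
exists (\prod_(i < n) (2 * phalf kap s alpha 0 0 i)).
  by apply: prodr_gt0 => i _; rewrite mulr_gt0// (phalf_gt0 par).
by rewrite lebn_box// => i; rewrite ltW// (phalf_gt0 par).
Qed.

End TestFunctionIntegral.

(** * Energy bound and failure of the inequality *)

Section Energy.
Context {R : realType} {m : nat}.
Local Notation n := m.+2.
Variables kap s alpha lam tau p delta : R.
Hypothesis par : admissible kap s alpha.
Hypothesis kap_lam : (2 : R) ^+ n * kap `^ lam = 1.
Hypotheses (tau0 : 0 < tau) (tau1 : tau < 1).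
Hypothesis alpha_tau : alpha * (2 * n%:R) <= unitq kap / 32 * (1 - tau).
Hypotheses (p1 : 1 < p) (delta0 : 0 < delta) (delta1 : delta < 1).
Hypothesis exponents :
  p * (n%:R + 1 - lam - s * (1 - delta)) <= s * (n%:R - 1) - lam + 1.

Local Notation q := (unitq kap).
Local Notation K j := (kap ^+ j).
Local Notation index := {ffun 'I_n -> seq bool}.
Local Notation G := (@apartments R m kap s alpha).
Local Notation T := (piece kap s alpha 2).
Local Notation width := (tube_width kap s alpha).
Local Notation amp := (amplitude (m := m) kap lam).
Local Notation u := (testf (m := m) kap s alpha lam).
Local Notation allcells := (@cells_upto m).

Definition test_slope (j : nat) : R := (amp j * (16 / (q * K j))) `^ p.

Definition tube_range (j : nat) : R := n%:R * (2 * width j) / (1 - tau).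

Lemma range_gt0 j : 0 < tube_range j.
Proof.
have t1 := tau1; have w0 := width_gt0 par j.
apply: divr_gt0; last by rewrite subr_gt0.
by apply: mulr_gt0 => //; exact: mulr_gt0.
Qed.

Lemma tube_volume j (w : index) :
  lebn (T j w) = (2 * q * K j * (2 * width j) ^+ m.+1)%:E.
Proof.
rewrite lebn_box => [|i]; last by rewrite ltW// (phalf_gt0 par).
rewrite big_ord_recl /= mulrA; congr (_ * _)%:E.
by rewrite (eq_bigr (fun=> 2 * width j)) ?prodr_const ?card_ord.
Qed.

(** From the centre of a ball the test function deviates at most with the slope of one tube, and
    only within [tube_range]; [singular_integral_le] turns this into the power p (1 - delta) of the
    range. *)
Lemma inner_integral_le : exists2 C : R, 0 <= C & forall J x, G x ->
  (\int[lebn (n:=n)]_(y in G `&` eball x (tau * dist_set x (boundary G)))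
     (`|u J x - u J y| `^ p / edist x y `^ (n%:R + delta * p))%:E <=
   (\sum_(c <- allcells J) test_slope c.1 * C * tube_range c.1 `^ (p * (1 - delta)) *
      \1_(T c.1 c.2) x)%:E)%E.
Proof.
have pp : 0 < p by move: p1; lra.
have pd : 0 < p * delta by rewrite mulr_gt0.
have pd1 : p * delta < p by rewrite gtr_pMr.
have [||C C0 HC] := @singular_integral_le R n p (n%:R + delta * p) pp.
- by rewrite addr_ge0// mulrC ltW.
- by rewrite ltrD2l mulrC.
have dE : n%:R + p - (n%:R + delta * p) = p * (1 - delta) by ring.
rewrite dE in HC.
exists C => // J x Gx.
have f0 y : 0 <= `|u J x - u J y| `^ p / edist x y `^ (n%:R + delta * p).
  by rewrite divr_ge0 ?powR_ge0.
have sl0 j : 0 <= test_slope j by exact: powR_ge0.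
have fN0 y : `|u J x - u J y| `^ p / edist x y `^ (n%:R + delta * p) != 0 ->
    u J x != u J y.
  by apply: contra_neq => ->; rewrite subrr normr0 powR0 ?mul0r// gt_eqF.
have term0 c : 0 <= test_slope c.1 * C * tube_range c.1 `^ (p * (1 - delta)) * \1_(T c.1 (c.2 : index)) x.
  by rewrite indicE !mulr_ge0// powR_ge0.
have [[j [w [jJ cw xT]]]|notube] :=
    pselect (exists j (w : index), [/\ (j < J)%N, cell j w & T j w x]); last first.
  apply: (@le_trans _ _ 0%E); last by rewrite lee_fin sumr_ge0.
  (* Away from the tubes the integrand vanishes on the ball: the case L = 0. *)
  have := HC x 1 0 (G `&` eball x (tau * dist_set x (boundary G)))
    (fun y => `|u J x - u J y| `^ p / edist x y `^ (n%:R + delta * p)) ltr01 (lexx 0).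
  rewrite !mul0r; apply; first by move=> y _; exact: f0.
  move=> y [_ xy] /fN0 ne; exfalso; apply: notube.
  by have [j [w [jJ cw xT _ _]]] := testf_diff par tau0 tau1 alpha_tau Gx xy ne; exists j, w.
apply: (@le_trans _ _ (test_slope j * C * tube_range j `^ (p * (1 - delta)))%:E).
  apply: (HC x); [exact: range_gt0|exact: sl0|by move=> y _; exact: f0|].
  move=> y [_ xy] /fN0 ne.
  have [j' [w' [j'J cw' xT' xyr le]]] := testf_diff par tau0 tau1 alpha_tau Gx xy ne.
  (* [testf_diff] returns a cell depending on [y]; both tubes contain [x], which identifies the
     generations. *)
  have [_ e] := tube_room_uniq par cw cw' (or_introl xT) (or_introl xT').
  rewrite e in xyr le; split=> //.
  rewrite mulrA ler_wpM2r ?invr_ge0 ?powR_ge0//.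
  have a0 : 0 <= amp j * (16 / (q * K j)).
    by rewrite mulr_ge0 ?divr_ge0// ltW// ?(amplitude_gt0 (m := m) lam par)// (qK_gt0 par).
  rewrite /test_slope -powRM ?edist_ge0//.
  have e0 := edist_ge0 x y.
  by apply: ge0_ler_powR => //; [exact: ltW|rewrite nnegrE mulr_ge0].
rewrite lee_fin (bigD1_seq (j, w)) ?uniq_cells_upto//=; last exact/mem_cells_upto.
have E1 : \1_(T j w) x = 1 :> R by rewrite indicE (mem_set xT).
rewrite E1 -[leLHS]mulr1 lerDl.
by apply: sumr_ge0 => c _; exact: term0.
Qed.

Lemma energy_le : exists2 C : R, 0 <= C & forall J,
  (\int[lebn (n:=n)]_(x in G)
     \int[lebn (n:=n)]_(y in G `&` eball x (tau * dist_set x (boundary G)))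
     (`|u J x - u J y| `^ p / edist x y `^ (n%:R + delta * p))%:E <=
   (C * J%:R)%:E)%E.
Proof.
have [kap0 kap12 s1 alpha0 alphaq] := par.
have pp : 0 < p by move: p1; lra.
have q0 := q_gt0 par; have t1 : 0 < 1 - tau by rewrite subr_gt0.
have [C C0 HC] := inner_integral_le.
pose d := p * (1 - delta).
pose cD : R := n%:R * (2 * alpha) / (1 - tau).
have cD0 : 0 <= cD by rewrite divr_ge0// ?mulr_ge0// ltW.
pose CT : R := (16 / q) `^ p * C * cD `^ d * (2 * q * (2 * alpha) ^+ m.+1).
have CT0 : 0 <= CT.
  apply: mulr_ge0.
    by apply: mulr_ge0; [apply: mulr_ge0 => //|]; exact: powR_ge0.
  by apply: mulr_ge0; [lra|apply: exprn_ge0; lra].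
exists CT => // J.
pose c j := test_slope j * C * tube_range j `^ d.
have c0 j : 0 <= c j by rewrite !mulr_ge0 ?powR_ge0.
have [mu muE] := lebn_measure R n.
apply: (@le_trans _ _ (\int[lebn (n:=n)]_x
    (\sum_(i <- allcells J) c i.1 * \1_(T i.1 i.2) x)%:E)%E).
  rewrite muE; apply: ge0_le_integral_subset => x.
  - move=> _; apply: integral_ge0 => y _.
    by rewrite lee_fin divr_ge0// powR_ge0.
  - by move=> _; rewrite lee_fin sumr_ge0// => i _; rewrite mulr_ge0// indicE.
  - by move=> Gx; split=> //; rewrite -muE; exact: HC.
rewrite ge0_integral_indic_sum//; last by move=> i; exact: measurable_box.
rewrite (eq_bigr (fun i => (c i.1 * (2 * q * K i.1 * (2 * width i.1) ^+ m.+1))%:E)); last first.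
  by move=> i _; rewrite tube_volume EFinM.
rewrite sumEFin lee_fin.
rewrite (sum_cells_upto J (fun j => c j * (2 * q * K j * (2 * width j) ^+ m.+1))).
apply: (@le_trans _ _ (\sum_(j < J) CT)); last first.
  by rewrite sumr_const card_ord mulr_natr.
apply: ler_sum => j _; have K0 := K_gt0 par j.
have K00 := ltW K0; have Kne : (K j == 0) = false by exact: gt_eqF.
(* The exponent collects the slope, the range, the tube length 1 and the cross-section s (n-1). The
   number of cells subtracts [lam], and [exponents] says that the total is at least 0. *)
have E : c j * (2 * q * K j * (2 * width j) ^+ m.+1) =
    CT * K j `^ ((lam - n%:R - 1) * p + s * d + 1 + s * m.+1%:R).
  have slE : test_slope j = (16 / q) `^ p * K j `^ ((lam - n%:R - 1) * p).
    have q160 : 0 <= 16 / q by rewrite divr_ge0// ltW.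
    rewrite powRrM -powRM ?powR_ge0// /test_slope; congr (_ `^ _).
    rewrite (powRD (r := lam - n%:R)) ?Kne ?implybT// powR_inv1//.
    by rewrite /amplitude; field; rewrite Kne gt_eqF.
  have raE : tube_range j `^ d = cD `^ d * K j `^ (s * d).
    rewrite powRrM -powRM ?powR_ge0//; congr (_ `^ _).
    by rewrite /tube_range /tube_width /cD; ring.
  have woE : (2 * width j) ^+ m.+1 = (2 * alpha) ^+ m.+1 * K j `^ (s * m.+1%:R).
    by rewrite /tube_width mulrA exprMn powRrM powR_mulrn ?powR_ge0.
  do 3! (rewrite powRD ?Kne ?implybT//).
  rewrite powRr1//.
  by rewrite /c slE raE woE /CT; ring.
rewrite E mulrCA (count_cells par kap_lam) ler_piMr//.
rewrite -[leRHS](powRr0 (K j)); apply: ger_powR; first by rewrite K0 (K_le1 par).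
move: exponents; rewrite /d -[n]addn1 natrD.
by lra.
Qed.

Lemma poincare_fails : ~ fractional_poincare G p delta tau.
Proof.
have pp : 0 < p by move: p1; lra.
have q0 := q_gt0 par.
move=> [c c0 Hc].
have [C C0 HC] := energy_le.
have [v v0 vE] := lebn_plate0 (m := m) par.
pose V := volume_bound (m := m) kap.
have V0 : 0 < V by rewrite exprn_gt0// mulr_gt0// (big_half_gt0 par).
have GV : (lebn G <= V%:E)%E.
  by rewrite -(lebn_big_box (m := m) par); apply: lebn_le; exact: apartments_sub_big_box.
have vG : (v%:E <= lebn G)%E.
  by rewrite -vE; apply: lebn_le; exact: plate0_sub.
(* [mean] goes through [fine], which sends infinite values to 0, so finiteness of the volume and of
   the integral has to be known. *)
have Gfin : lebn G \is a fin_num.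
  by rewrite fin_numE; apply/andP; split; apply/eqP => e; move: GV vG; rewrite e.
have lG0 : 0 < fine (lebn G).
  by rewrite -lte_fin fineK// (lt_le_trans _ vG)// lte_fin.
have lGV : fine (lebn G) <= V by rewrite -lee_fin fineK.
pose b : R := (q / 2) ^+ n.
have b0 : 0 < b by rewrite exprn_gt0// divr_gt0.
apply: (@linear_not_le_root R (b / V * v) (c * C `^ p^-1) p) => //.
- by rewrite mulr_gt0// divr_gt0.
- by rewrite mulr_ge0 ?powR_ge0// ltW.
move=> J.
have Ilo := integral_testf_ge par kap_lam J.
have Iup : (\int[lebn (n:=n)]_(x in G) (u J x)%:E <= (amplitude_total (m := m) kap lam J * V)%:E)%E.
  by apply: (integral_bounded par) => x; [exact: (testf_ge0 lam par)|exact: testf_le].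
have Ifin : (\int[lebn (n:=n)]_(x in G) (u J x)%:E)%E \is a fin_num.
  by rewrite fin_numE; apply/andP; split; apply/eqP => e; move: Ilo Iup; rewrite e.
have meanlo : J%:R * b / V <= mean G (u J).
  rewrite /mean; apply: ler_pM.
  - by rewrite mulr_ge0// ltW.
  - by rewrite invr_ge0 ltW.
  - by rewrite -lee_fin fineK.
  - by rewrite lef_pV2 ?posrE.
have mean0 : 0 <= mean G (u J).
  apply: le_trans meanlo; apply: divr_ge0; last exact: ltW.
  by apply: mulr_ge0 => //; exact: ltW.
have := Hc (u J) (testf_Lp lam par p1 J).
set E := (X in poweR X _) => H.
have E0 : (0 <= E)%E.
  have [mu muE] := lebn_measure R n; rewrite /E muE.
  apply: integral_ge0 => x _; apply: integral_ge0 => y _.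
  by rewrite lee_fin divr_ge0// powR_ge0.
have EC : (poweR E p^-1 <= (C `^ p^-1 * J%:R `^ p^-1)%:E)%E.
  rewrite -powRM// -poweR_EFin; apply: gt0_ler_poweR.
  - by rewrite invr_ge0 ltW.
  - by rewrite in_itv /= E0 leey.
  - by rewrite in_itv /= lee_fin leey mulr_ge0.
  - exact: HC.
have lower : ((mean G (u J) * v)%:E <=
    \int[lebn (n:=n)]_(x in G) (`|u J x - mean G (u J)|)%:E)%E.
  have [mu muE] := lebn_measure R n.
  have <- : (\int[mu]_(x in plate0 (m := m) kap s alpha) (cst (mean G (u J))%:E x) =
      (mean G (u J) * v)%:E)%E.
    rewrite integral_cst; last exact: measurable_box.
    by rewrite [in RHS]EFinM -vE muE.
  rewrite [X in integral X G]muE; apply: ge0_le_integral_subset => x px /=.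
  - by rewrite lee_fin.
  - by rewrite lee_fin.
  - split; first exact: plate0_sub px.
    by rewrite (testf_plate0 lam par J px) sub0r normrN ger0_norm.
have := le_trans lower (le_trans H (lee_wpmul2l _ EC)).
rewrite lee_fin => /(_ (ltW c0)); rewrite -EFinM lee_fin => fin.
apply: (@le_trans _ _ (mean G (u J) * v)).
  rewrite (_ : J%:R * (b / V * v) = J%:R * b / V * v); last by ring.
  by apply: ler_wpM2r meanlo; exact: ltW.
by rewrite -mulrA.
Qed.

End Energy.

(** * Choice of the parameters *)

(** The ratio is 2^(-n/lam), which is below 1/2 because lam < n. *)
Lemma cantor_ratio (R : realType) (n : nat) (lam : R) : 0 < lam -> lam < n%:R ->
  exists kap : R, [/\ 0 < kap, kap < 2^-1 & 2 ^+ n * kap `^ lam = 1].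
Proof.
move=> lam0 lamn; exists (2 `^ (- (n%:R / lam))); split.
- exact: powR_gt0.
- rewrite powRN ltf_pV2 ?posrE ?powR_gt0// -[ltLHS]powRr1// /powR !gt_eqF//.
  rewrite ltr_expR ltr_pM2r; last by rewrite ln_gt0// ltr1n.
  by rewrite ltr_pdivlMr// mul1r.
- rewrite -powRrM mulNr divfK ?gt_eqF// powRN powR_mulrn//.
  by rewrite divff// gt_eqF// exprn_gt0.
Qed.

Theorem theorem6p3 (R : realType) (n : nat) (s p lam delta tau : R) :
  (2 <= n)%N -> 1 < s -> 1 < p ->
  n%:R - 1 <= lam -> lam < n%:R ->
  0 < delta -> delta < 1 -> 0 < tau -> tau < 1 ->
  s < (n%:R + 1 - lam) / (1 - delta) ->
  p <= (s * (n%:R - 1) - lam + 1) / (n%:R - s * (1 - delta) - lam + 1) ->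
  exists G : set (n.-tuple R),
    [/\ John_domain s G,
        minkowski_dim (boundary G) = lam%:E &
        ~ fractional_poincare G p delta tau].
Proof.
case: n => [|[|m]]// _ s1 p1 lam1 lamn d0 d1 t0 t1 sub pub.
have lam0 : 0 < lam.
  by move: lam1; rewrite -[m.+2]addn1 natrD addrK; apply: lt_le_trans; rewrite ltr0n.
have [kap [kap0 kap12 kap_lam]] := cantor_ratio lam0 lamn.
have n0 : 0 < m.+2%:R :> R by rewrite ltr0n.
have n1 : 1 <= m.+2%:R :> R by rewrite ler1n.
have q0 : 0 < unitq kap by rewrite divr_gt0// gap_gt0.
have t10 : 0 < 1 - tau by rewrite subr_gt0.
(* Turns [alpha_tau] into an equality; [alpha <= unitq kap / 16] then follows from n >= 1 and 1 -
   tau <= 1. *)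
pose alpha : R := unitq kap * (1 - tau) / (64 * m.+2%:R).
have alpha0 : 0 < alpha by apply: divr_gt0; exact: mulr_gt0.
have alpha_tau : alpha * (2 * m.+2%:R) <= unitq kap / 32 * (1 - tau).
  rewrite le_eqVlt; apply/orP; left; apply/eqP; rewrite /alpha.
  by field; rewrite gt_eqF.
have par : admissible kap s alpha.
  split=> //; have h : alpha * 2 <= alpha * (2 * m.+2%:R).
    by rewrite ler_pM2l// ler_pMr.
  have : unitq kap / 32 * (1 - tau) <= unitq kap / 32 * 1.
    by rewrite ler_pM2l ?divr_gt0//; lra.
  by move: h alpha_tau; lra.
(* The hypothesis on [s] makes the denominator in the bound on [p] positive, so it can be
   cleared. *)
have sd : s * (1 - delta) < m.+2%:R + 1 - lam.
  by move: sub; rewrite ltr_pdivlMr// subr_gt0.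
exists (apartments kap s alpha); split.
- exact: apartments_John.
- exact: (minkowski_dim_apartments par kap_lam lam1 lamn).
- apply: (poincare_fails par kap_lam t0 t1 alpha_tau p1 d0 d1).
  move: pub; rewrite ler_pdivlMr; last by lra.
  rewrite (_ : m.+2%:R - s * (1 - delta) - lam + 1 =
    m.+2%:R + 1 - lam - s * (1 - delta)) //; ring.
Qed.
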